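(* Let $R\subseteq\{0,1\}^k$ be a fixed $k$-ary Boolean relation and $d$ a fixed integer such that for every $u\in\{0,1\}^k\setminus R$ there exist a ring $E_u\in\{\mathbb{Q}\}\cup\{\mathbb{Z}/q\mathbb{Z} : q \text{ is a prime power}\}$ and a polynomial $p_u$ over $E_u$ of degree at most $d$ that captures $u$ with respect to $R$. Then there is a polynomial-time algorithm that, given a set $\mathcal{C}$ of constraints over $\{R\}$ on $n$ variables, outputs $\mathcal{C}'\subseteq\mathcal{C}$ with $|\mathcal{C}'|=O(n^d)$ such that any Boolean assignment satisfies all constraints in $\mathcal{C}$ if and only if it satisfies all constraints in $\mathcal{C}'$.
   Context: A constraint over $\{R\}$ is $R(x_1,\ldots,x_k)$ with variables $x_i$; a Boolean assignment $f$ satisfies it if $(f(x_1),\ldots,f(x_k))\in R$. A polynomial $p_u$ in $k$ variables over a ring $E_u$ captures $u\in\{0,1\}^k\setminus R$ with respect to $R$ if, evaluated over $E_u$, $p_u(x_1,\ldots,x_k)=0$ for all $(x_1,\ldots,x_k)\in R$ and $p_u(u_1,\ldots,u_k)\neq 0$. *)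

(* Defs.v *)
From HB Require Import structures.
From mathcomp Require Import all_boot all_order all_algebra.
From mathcomp Require Import mpoly.

Set Implicit Arguments.
Unset Strict Implicit.
Unset Printing Implicit Defensive.

Import GRing.Theory.

Section Constraints.
Variables (k : nat) (R : {set k.-tuple bool}).

(** [R(x_1, .., x_k)] over the variables ['I_n]; variables may repeat. *)
Definition constraint (n : nat) := k.-tuple 'I_n.

Definition satisfies n (f : 'I_n -> bool) (c : constraint n) : bool :=
  map_tuple f c \in R.

Definition satisfies_all n (f : 'I_n -> bool) (C : {set constraint n}) : Prop :=
  forall c, c \in C -> satisfies f c.

Definition eval01 (E : comNzRingType) (p : {mpoly E[k]}) (x : k.-tuple bool) : E :=
  p.@[fun i => (nat_of_bool (tnth x i))%:R%R].

Definition captures (E : comNzRingType) (p : {mpoly E[k]}) (u : k.-tuple bool) :=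
  (forall x, x \in R -> eval01 p x = 0%R) /\ eval01 p u <> 0%R.

Definition prime_power (q : nat) : Prop :=
  exists p e : nat, [/\ prime p, 0 < e & q = p ^ e].

(** [msize p] is the total degree plus one, and [0] for the zero polynomial. *)
Definition captured_in_degree (E : comNzRingType) (d : nat) (u : k.-tuple bool) :=
  exists p : {mpoly E[k]}, msize p <= d.+1 /\ captures p u.

(** A prime power is at least 2, so ['Z_q] is the ring of integers mod [q]. *)
Definition capturable (d : nat) (u : k.-tuple bool) : Prop :=
  captured_in_degree rat d u \/
  exists2 q, prime_power q & captured_in_degree 'Z_q d u.

End Constraints.

(** A model of running time: the random access machine of Cook and Reckhow (Time
    bounded random access machines, 1973), with natural numbers as register
    contents and truncated subtraction, at unit cost per instruction.  As there
    is no multiplication, the numbers that a fixed program produces in [t] steps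
    are at most [t + O(1)] bits longer than those in its input, so polynomial time
    here is the same as polynomial time on Turing machines. *)
Inductive instr :=
  | IConst of nat & nat
  | IAdd of nat & nat & nat
  | ISub of nat & nat & nat
  | ILoad of nat & nat
  | IStore of nat & nat
  | IJpos of nat & nat
  | IRead of nat
  | IPrint of nat.

Definition program := seq instr.

Record state := State {
  pc : nat;
  mem : nat -> nat;
  inp : seq nat;
  out : seq nat }.

Definition upd (m : nat -> nat) (i v : nat) : nat -> nat :=
  fun j => if j == i then v else m j.

Definition exec (op : instr) (s : state) : state :=
  let: State pc m inp out := s in
  match op with
  | IConst i c => State pc.+1 (upd m i c) inp out
  | IAdd i j l => State pc.+1 (upd m i (m j + m l)) inp out
  | ISub i j l => State pc.+1 (upd m i (m j - m l)) inp out
  | ILoad i j => State pc.+1 (upd m i (m (m j))) inp out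
  | IStore i j => State pc.+1 (upd m (m i) (m j)) inp out
  | IJpos j l => State (if 0 < m j then l else pc.+1) m inp out
  | IRead i => State pc.+1 (upd m i (head 0 inp)) (behead inp) out
  | IPrint i => State pc.+1 m inp (rcons out (m i))
  end.

(** The machine halts by leaving the program. *)
Definition step (P : program) (s : state) : state :=
  if onth P (pc s) is Some op then exec op s else s.

Definition halted (P : program) (s : state) : bool := size P <= pc s.

Definition initial (v : seq nat) : state := State 0 (fun=> 0) v [::].

(** Since halted states are fixed, this says that [P] halts on input [v] after at
    most [t] steps, with output [w]. *)
Definition computes_within (P : program) (t : nat) (v w : seq nat) : Prop :=
  let s := iter t (step P) (initial v) in halted P s /\ out s = w.

Definition lists (T : finType) (s : seq T) (C : {set T}) : Prop :=
  uniq s /\ s =i C.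

(** The number of variables, the number of constraints, then the constraints
    as consecutive blocks of [k] variable indices. *)
Definition encode k n (s : seq (constraint k n)) : seq nat :=
  n :: size s :: flatten [seq [seq val x | x <- tval c] | c <- s].

(* Main.v *)
(** Rational polynomials can be replaced by polynomials modulo an integer: clear
    denominators and take a modulus larger than the value at [u].  Multiplying the
    coefficients for [u] by [q / q_u] then gives all of them a common modulus [q],
    not necessarily a prime power.  Over all non-members [u] of [R] together, a
    constraint becomes a vector modulo [q] indexed by words of length [d] over the
    [n] variables and the constant 1, and an assignment [f] satisfies it as soon as
    the evaluation functionals of [f] vanish on that vector.

    The program keeps a table of rows, row [i] being zero before column [i].  It
    reduces the vector of each constraint, column by column, by adding row [i] as
    long as this makes entry [i] wrap around [q].  If some entry stays positive, the
    negative of the current vector replaces row [i] and the constraint is kept.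
    Each replacement increases the sum of the diagonal, which is at most [q] times
    the number [2^k (n+1)^d] of columns; a vector reduced to zero is killed by every
    functional that kills the kept ones.  No pivot has to be invertible, nor does the
    table have to generate the whole span. *)
Require Import Defs.
From mathcomp Require Import all_boot all_order all_algebra.
From mathcomp Require Import mpoly.
From mathcomp Require Import zify.

Set Implicit Arguments.
Unset Strict Implicit.
Unset Printing Implicit Defensive.

Import Order.TTheory GRing.Theory Num.Theory.

(** * Capturing terms with a common modulus *)

(** [None] is a padding letter of value 1, so that a monomial of degree at most [d] becomes a word
    of length exactly [d]; a repeated letter expresses an exponent. *)
Definition monval k (x : k.-tuple bool) (w : seq (option 'I_k)) : nat :=
  \prod_(o <- w) (if o is Some i then nat_of_bool (tnth x i) else 1).

Definition termval k (x : k.-tuple bool) (ts : seq (nat * seq (option 'I_k))) : nat :=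
  \sum_(t <- ts) t.1 * monval x t.2.

Lemma eval01_terms k d (E : comNzRingType) (p : {mpoly E[k]}) : msize p <= d.+1 ->
  exists2 ts : seq (E * seq (option 'I_k)), all (fun t => size t.2 == d) ts &
    forall x, eval01 p x = (\sum_(t <- ts) t.1 * (monval x t.2)%:R)%R.
Proof.
move=> le_pd.
pose w (m : 'X_{1..k}) : seq (option 'I_k) :=
  flatten [seq nseq (m i) (Some i) | i <- enum 'I_k] ++ nseq (d - mdeg m) None.
exists [seq (p@_m, w m)%R | m <- msupp p].
  apply/allP => _ /mapP[m hm ->] /=.
  have le_m : mdeg m <= d by have := msize_mdeg_lt hm; lia.
  rewrite size_cat size_nseq size_flatten /shape -map_comp sumnE big_map big_enum /=.
  under eq_bigr do rewrite size_nseq.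
  by rewrite -mdegE subnKC.
move=> x; rewrite /eval01 mevalE [RHS]big_map; apply: eq_bigr => m _ /=; congr (_ * _)%R.
rewrite /monval big_cat /= [X in _ * X]big1_seq ?muln1; last first.
  by move=> o /andP[_ /nseqP[-> _]].
rewrite big_flatten /= big_map big_enum /= natr_prod.
by apply: eq_big => // i _; rewrite big_nseq iter_muln muln1 natrX.
Qed.

Lemma Zq_natr_eq0 q m : 1 < q -> ((m%:R : 'Z_q) == 0)%R = (q %| m).
Proof. by move=> q1; rewrite -val_eqE /= val_Zp_nat. Qed.

(** [D] is a product of denominators, built by induction on the list. The second components carry
    the words along, so that the scaled list is again a list of terms. *)
Lemma common_denominator (T : eqType) (s : seq (rat * T)) :
  exists2 D : int, D != 0%R & exists z : seq (int * T),
    map snd z = map snd s /\ [seq t.1%:~R | t <- z]%R = [seq D%:~R * t.1 | t <- s]%R :> seq rat.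
Proof.
elim: s => [|[a w] s [D D0 [z [hz1 hz2]]]]; first by exists 1%R => //; exists [::].
exists (denq a * D)%R; first by rewrite mulf_neq0 // denq_neq0.
exists ((numq a * D, w)%R :: [seq (denq a * t.1, t.2)%R | t <- z]); split.
  by rewrite /= -map_comp -hz1.
rewrite /= -!map_comp; congr cons.
  by rewrite !rmorphM /= numqE [RHS]mulrAC; congr (_ * _)%R; apply: mulrC.
rewrite [LHS](_ : _ = [seq (denq a)%:~R * y | y <- [seq t.1%:~R | t <- z]])%R; last first.
  by rewrite -map_comp; apply: eq_map => t /=; rewrite rmorphM.
by rewrite hz2 -map_comp; apply: eq_map => t /=; rewrite rmorphM mulrA.
Qed.

Lemma capturable_terms k d (R : {set k.-tuple bool}) u : capturable R d u ->
  exists (q : nat) (ts : seq (nat * seq (option 'I_k))),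
    [/\ 1 < q, all (fun t => size t.2 == d) ts,
        forall x, x \in R -> q %| termval x ts & ~~ (q %| termval u ts)].
Proof.
(* Coefficients in ['Z_q] suffice: their representatives in [nat] turn vanishing into divisibility
   by [q]. *)
suff main : (exists q (ts : seq ('Z_q * seq (option 'I_k))), [/\ 1 < q,
    all (fun t => size t.2 == d) ts,
    forall x, x \in R -> (\sum_(t <- ts) t.1 * (monval x t.2)%:R = 0)%R &
    (\sum_(t <- ts) t.1 * (monval u t.2)%:R != 0)%R]) ->
  exists (q : nat) (ts : seq (nat * seq (option 'I_k))),
    [/\ 1 < q, all (fun t => size t.2 == d) ts,
        forall x, x \in R -> q %| termval x ts & ~~ (q %| termval u ts)].
  move=> h; apply: main; case: h => [[p [hp [pR pu]]] | [q hq [p [hp [pR pu]]]]].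
    have [ts hts tsE] := eval01_terms hp.
    have [D D0 [z [z2 z1]]] := common_denominator ts.
    pose S x := (\sum_(t <- z) t.1 * (monval x t.2)%:R : int)%R.
    have SE x : ((S x)%:~R = D%:~R * eval01 p x :> rat)%R.
      rewrite tsE /S rmorph_sum /=.
      elim: (z) (ts) z2 z1 {hts tsE} => [|[a w] z' IH] [|[b w'] ts'] //=.
        by rewrite !big_nil mulr0.
      move=> [-> h2] [h1 h1']; rewrite !big_cons mulrDr (IH ts') //=.
      by rewrite rmorphM rmorph_nat /= h1 mulrA.
    have Su : S u != 0%R.
      rewrite -(intr_eq0 rat) SE mulf_neq0 ?intr_eq0 //; exact/eqP.
    (* The integer [S u] is nonzero and smaller than this modulus in absolute value, hence not
       divisible by it, whereas [S x] is 0 on [R]. *)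
    pose q := `|S u|.+1; have q1 : 1 < q by rewrite ltnS absz_gt0.
    exists q, [seq (t.1%:~R, t.2)%R | t <- z].
    have castE x : (\sum_(t <- [seq (t.1%:~R, t.2)%R | t <- z]) t.1 * (monval x t.2)%:R
                    = (S x)%:~R :> 'Z_q)%R.
      rewrite big_map /S rmorph_sum /=; apply: eq_bigr => t _.
      by rewrite rmorphM rmorph_nat.
    split=> //.
    - rewrite all_map; have : all (fun w => size w == d) (map snd z).
        by rewrite z2 all_map.
      by rewrite all_map.
    - move=> x /pR px; rewrite castE; suff -> : S x = 0%R by [].
      by apply/eqP; rewrite -(intr_eq0 rat) SE px mulr0.
    have : `|S u| < q by []; rewrite castE.
    case: (intP (S u)) q q1 Su {castE} => // n q q1 _ lt_nq.
    - by rewrite -pmulrn Zq_natr_eq0 // gtnNdvd.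
    - by rewrite mulrNz oppr_eq0 -pmulrn Zq_natr_eq0 // gtnNdvd.
  have q1 : 1 < q.
    by case: hq => r [e [pr e0 ->]]; apply: leq_trans (leq_pexp2l (prime_gt0 pr) e0); exact: prime_gt1.
  have [ts hts tsE] := eval01_terms hp.
  exists q, ts; split=> // [x /pR|]; first by rewrite tsE.
  by rewrite -tsE; apply/eqP.
case=> q [ts [q1 hts tR tu]]; exists q, [seq (nat_of_ord t.1, t.2) | t <- ts].
have castE x : ((termval x [seq (nat_of_ord t.1, t.2) | t <- ts])%:R
                = \sum_(t <- ts) t.1 * (monval x t.2)%:R :> 'Z_q)%R.
  rewrite /termval big_map natr_sum; apply: eq_bigr => t _.
  by rewrite natrM /= natr_Zp.
split=> // [|x xR|]; first by rewrite all_map.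
  by rewrite -Zq_natr_eq0 // castE tR.
by rewrite -Zq_natr_eq0 // castE.
Qed.

(** Since [(f u).1] divides [q], scaling by [q %/ (f u).1] turns divisibility by [(f u).1] into
    divisibility by [q]. The scaled coefficients are then reduced below [q], as the program
    expects. *)
Lemma common_modulus k d (R : {set k.-tuple bool}) :
  (forall u, u \notin R -> capturable R d u) ->
  exists (q : nat) (ts : k.-tuple bool -> seq (nat * seq (option 'I_k))),
    [/\ 1 < q, forall u, all (fun t => (t.1 < q) && (size t.2 == d)) (ts u),
        forall u x, x \in R -> q %| termval x (ts u) &
        forall u, u \notin R -> ~~ (q %| termval u (ts u))].
Proof.
move=> hR.
have /fin_all_exists[f hf] u : exists qt : nat * seq (nat * seq (option 'I_k)),
    [/\ 1 < qt.1, all (fun t => size t.2 == d) qt.2,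
        forall x, x \in R -> qt.1 %| termval x qt.2 &
        u \notin R -> ~~ (qt.1 %| termval u qt.2)].
  have [uR|/hR/capturable_terms[q [ts []]]] := boolP (u \in R); last by exists (q, ts).
  by exists (2, [::]); split=> //= x _; rewrite /termval big_nil.
have q0 u : 0 < (f u).1 by have [h _ _ _] := hf u; lia.
pose q := 2 * \prod_u (f u).1.
have qgt0 : 0 < q by rewrite muln_gt0 prodn_gt0.
have qE u : q = (q %/ (f u).1) * (f u).1.
  by rewrite divnK // /q (bigD1 u) //= mulnCA dvdn_mulr.
pose ts u := [seq (q %/ (f u).1 * t.1 %% q, t.2) | t <- (f u).2].
have tsE u x : (q %| termval x (ts u)) = ((f u).1 %| termval x (f u).2).
  have q'0 : 0 < q %/ (f u).1 by have := qE u; lia.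
  rewrite -[RHS](dvdn_pmul2l q'0) -qE /termval big_map big_distrr /= /dvdn.
  rewrite -modn_summ -[in RHS]modn_summ; congr (_ %% _ == _); apply: eq_bigr => t _.
  by rewrite modnMml mulnA.
exists q, ts; split=> [|u|u x xR|u uR].
- by rewrite /q; have : 0 < \prod_u (f u).1; [rewrite prodn_gt0 | lia].
- have [_ h _ _] := hf u; rewrite all_map; apply: sub_all h => t /= ->.
  by rewrite ltn_mod qgt0.
- by rewrite tsE; have [_ _ h _] := hf u; apply: h.
- by rewrite tsE; have [_ _ _ h] := hf u; apply: h.
Qed.

(** * Structured programs *)

(** A state without its program counter, so that assertions about code do not depend on where it is
    placed. *)
Record data := Data { dmem : nat -> nat; dinp : seq nat; dout : seq nat }.

Definition at_pc (o : nat) (x : data) : state := State o (dmem x) (dinp x) (dout x).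

Definition exec_data (op : instr) (x : data) : data :=
  let: Data m i o := x in
  match op with
  | IConst r c => Data (upd m r c) i o
  | IAdd r j l => Data (upd m r (m j + m l)) i o
  | ISub r j l => Data (upd m r (m j - m l)) i o
  | ILoad r j => Data (upd m r (m (m j))) i o
  | IStore r j => Data (upd m (m r) (m j)) i o
  | IJpos _ _ => x
  | IRead r => Data (upd m r (head 0 i)) (behead i) o
  | IPrint r => Data m i (rcons o (m r))
  end.

Definition is_jump (op : instr) : bool := if op is IJpos _ _ then true else false.

Inductive cmd :=
  | Ops of seq instr
  | Seq of cmd & cmd
  | While of nat & cmd.

Fixpoint csize (c : cmd) : nat :=
  match c with
  | Ops l => size l
  | Seq c1 c2 => csize c1 + csize c2
  | While _ c => (csize c).+3
  end.

(* Register 0 only serves to turn the conditional jump into an unconditional one. *)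
Fixpoint compile (o : nat) (c : cmd) : program :=
  match c with
  | Ops l => l
  | Seq c1 c2 => compile o c1 ++ compile (o + csize c1) c2
  | While r c =>
      [:: IConst 0 1; IJpos 0 (o.+2 + csize c)] ++ compile o.+2 c ++ [:: IJpos r o.+2]
  end.

Lemma size_compile c o : size (compile o c) = csize c.
Proof.
elim: c o => [l|c1 IH1 c2 IH2|r c IH] o //=; rewrite ?size_cat ?IH1 ?IH2 ?IH //=.
by rewrite addn1.
Qed.

(* Total correctness with a time bound, wherever the code of [c] is placed. *)
Definition wp (c : cmd) (T : nat) (Q : data -> Prop) (x : data) : Prop :=
  forall pre post, let P := pre ++ compile (size pre) c ++ post in
  exists t y, [/\ t <= T, iter t (step P) (at_pc (size pre) x) = at_pc (size pre + csize c) y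
                & Q y].

Lemma wp_weaken c T T' (Q Q' : data -> Prop) x :
  wp c T Q x -> T <= T' -> (forall y, Q y -> Q' y) -> wp c T' Q' x.
Proof.
move=> h le_T QQ' pre post; have [t [y [le_t run Qy]]] := h pre post.
by exists t, y; split; [apply: leq_trans le_T | | apply: QQ'].
Qed.

Lemma wp_time c T T' (Q : data -> Prop) x : wp c T Q x -> T <= T' -> wp c T' Q x.
Proof. by move=> h le_T; apply: wp_weaken h le_T _. Qed.

Lemma wp_seq c1 c2 T1 T2 (Q : data -> Prop) x :
  wp c1 T1 (wp c2 T2 Q) x -> wp (Seq c1 c2) (T1 + T2) Q x.
Proof.
move=> h pre post; rewrite /= -catA.
have [t1 [y [le1 run1 /(_ (pre ++ compile (size pre) c1) post)]]] :=
  h pre (compile (size pre + csize c1) c2 ++ post).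
rewrite size_cat size_compile -!catA => -[t2 [z [le2 run2 Qz]]].
exists (t2 + t1), z; split=> //; first by rewrite addnC leq_add.
by rewrite iterD run1 run2 addnA.
Qed.

Lemma step_at P o x op :
  onth P o = Some op -> ~~ is_jump op -> step P (at_pc o x) = at_pc o.+1 (exec_data op x).
Proof. by rewrite /step /= => ->; case: x; case: op. Qed.

Lemma step_jump P o x r l :
  onth P o = Some (IJpos r l) ->
  step P (at_pc o x) = at_pc (if 0 < dmem x r then l else o.+1) x.
Proof. by rewrite /step /= => ->. Qed.

Lemma onth_at (pre post : program) op :
  onth (pre ++ op :: post) (size pre) = Some op.
Proof. by rewrite onth_cat ltnn subnn. Qed.

Lemma wp_ops l (Q : data -> Prop) x :
  all (fun op => ~~ is_jump op) l -> Q (foldl (fun y op => exec_data op y) x l) ->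
  wp (Ops l) (size l) Q x.
Proof.
move=> hl hQ pre post /=.
exists (size l), (foldl (fun y op => exec_data op y) x l); split=> //.
elim: l pre x hl {hQ} => [|op l IH] pre x /=; first by rewrite addn0.
move=> /andP[hop hl]; rewrite -iterS iterSr (step_at _ (onth_at pre (l ++ post) op) hop).
have:= IH (rcons pre op) (exec_data op x) hl.
by rewrite size_rcons cat_rcons addSnnS => ->.
Qed.

(** The index of [I] bounds the remaining rounds: a positive test register forces a predecessor. The
    3 pays for setting register 0, the entry jump and the final test; each round costs its body and
    one test. *)
Lemma wp_while r c T (I : nat -> data -> Prop) (Q : data -> Prop) n x :
  (forall n x, I n x -> 0 < dmem x r -> exists2 n', n = n'.+1 & wp c T (I n') x) ->
  (forall n x, I n x -> dmem x r = 0 -> Q x) ->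
  I n (exec_data (IConst 0 1) x) -> wp (While r c) (3 + n * T.+1) Q x.
Proof.
move=> hI hQ hx pre post; rewrite /=.
set P := pre ++ _; set o := size pre.
have P0 : onth P o = Some (IConst 0 1) by rewrite onth_at.
have P1 : onth P o.+1 = Some (IJpos 0 (o.+2 + csize c)).
  by rewrite /P -cat_rcons -(size_rcons pre (IConst 0 1)) onth_at.
pose pre2 := pre ++ [:: IConst 0 1; IJpos 0 (o.+2 + csize c)].
have sz2 : size pre2 = o.+2 by rewrite size_cat addn2.
have PE : P = pre2 ++ compile o.+2 c ++ (IJpos r o.+2) :: post.
  by rewrite /P /pre2 -!catA.
have P2 : onth P (o.+2 + csize c) = Some (IJpos r o.+2).
  by rewrite PE catA -sz2 -(size_compile c (size pre2)) -size_cat onth_at.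
suff [t [y [le_t run Qy]]] : exists t y, [/\ t <= (n * T.+1).+1,
    iter t (step P) (at_pc (o.+2 + csize c) (exec_data (IConst 0 1) x)) =
      at_pc (o.+2 + csize c).+1 y & Q y].
  exists (t + 2), y; split=> //; first by lia.
  have J : 0 < dmem (exec_data (IConst 0 1) x) 0 by case: (x).
  by rewrite iterD [iter 2 _ _]/= (step_at _ P0) // (step_jump _ P1) J run;
    congr at_pc; lia.
elim: n {hx x} (exec_data _ x) hx => [|n IH] x hx.
  have [h|] := ltnP 0 (dmem x r); first by have [] := hI _ _ hx h.
  rewrite leqn0 => /eqP h; exists 1, x; rewrite /= (step_jump _ P2) h /=.
  by split=> //; apply: hQ hx h.
have [h|] := ltnP 0 (dmem x r); last first.
  rewrite leqn0 => /eqP h; exists 1, x; rewrite /= (step_jump _ P2) h /=.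
  by split=> //; apply: hQ hx h.
have [n' [<-] hc] := hI _ _ hx h.
have [t [y [le_t run Iy]]] := hc pre2 (IJpos r o.+2 :: post).
have [t' [z [le_t' run' Qz]]] := IH y Iy.
exists (t' + (t + 1)), z; split=> //; first by lia.
rewrite !iterD /= (step_jump _ P2) h.
by move: run; rewrite sz2 -PE => ->.
Qed.

(** A conditional is a loop whose body clears its own test register. Register 0 is excluded because
    loop entry overwrites it. *)
Lemma wp_when r c T (Q : data -> Prop) x : r != 0 ->
  (dmem x r = 0 -> Q (exec_data (IConst 0 1) x)) ->
  (0 < dmem x r -> wp c T (fun y => dmem y r = 0 /\ Q y) (exec_data (IConst 0 1) x)) ->
  wp (While r c) (4 + T) Q x.
Proof.
move=> r0 h0 h1; have mr : dmem (exec_data (IConst 0 1) x) r = dmem x r.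
  by case: x {h0 h1} => m i o /=; rewrite /upd (negPf r0).
pose I n y := (n = 1 /\ y = exec_data (IConst 0 1) x) \/ (dmem y r = 0 /\ Q y).
apply: (@wp_time _ (3 + 1 * T.+1)); last by rewrite mul1n.
apply: (@wp_while _ _ _ I); last by left.
- move=> n y [[-> ->]|[-> //]]; rewrite mr => lt0; exists 0 => //.
  by apply: (wp_weaken (h1 lt0)) => // z hz; right.
- by move=> n y [[_ ->]|[_ //]]; rewrite mr.
Qed.

Lemma wp_computes c T v (Q : data -> Prop) :
  wp c T Q (Data (fun=> 0) v [::]) ->
  exists2 y, Q y & computes_within (compile 0 c) T v (dout y).
Proof.
move=> /(_ [::] [::]); rewrite /= cats0 => -[t [y [le_t run Qy]]]; exists y => //.
rewrite /computes_within -(subnK le_t) iterD.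
have -> : initial v = at_pc 0 (Data (fun=> 0) v [::]) by [].
rewrite run add0n; set s := at_pc _ _.
have -> k : iter k (step (compile 0 c)) s = s.
  elim: k => //= k ->; rewrite /step /s /= -(size_compile c 0).
  by rewrite onth_default.
by rewrite /halted /= size_compile.
Qed.

(** * Linear algebra modulo q *)

(** One conditional subtraction is a full reduction below [q + q]. This covers every sum formed:
    vector entries and coefficients are below [q], row entries at most [q]. *)
Definition redm q a := if a < q then a else a - q.

Definition dotv q M (v : nat -> nat) (phi : nat -> 'Z_q) : 'Z_q :=
  (\sum_(j < M) (v j)%:R * phi j)%R.

Definition annih q M (W : nat -> nat -> nat) (phi : nat -> 'Z_q) : Prop :=
  forall a, a < M -> dotv M (W a) phi = 0%R.

(** Rows are stored as [q - v] without reduction, so the entry [q] also represents zero; hence the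
    two values allowed before the diagonal. A diagonal entry is 0 at the start, or [q - v] with [v]
    positive. *)
Definition rows_ok q M (W : nat -> nat -> nat) : Prop :=
  forall a, a < M -> [/\ W a a < q, forall b, b < M -> W a b <= q
                       & forall b, b < a -> W a b = 0 \/ W a b = q].

Definition potential M (W : nat -> nat -> nat) : nat := \sum_(a < M) W a a.

Lemma redm_lt q a : a < q + q -> redm q a < q.
Proof. by rewrite /redm; case: ifP; lia. Qed.

Lemma redm_natr q a : 1 < q -> ((redm q a)%:R = a%:R :> 'Z_q)%R.
Proof.
move=> q1; rewrite /redm; case: ifP => // lt_aq; have le_qa : q <= a by lia.
by rewrite natrB // [X in (_ - X)%R](_ : _ = 0%R) ?subr0 //; apply/eqP; rewrite Zq_natr_eq0 ?dvdnn.
Qed.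

Lemma eq_dotv q M v w (phi : nat -> 'Z_q) :
  (forall j, j < M -> v j = w j) -> dotv M v phi = dotv M w phi.
Proof. by move=> h; apply: eq_bigr => j _; rewrite h. Qed.

Lemma dotv0 q M v (phi : nat -> 'Z_q) : (forall j, j < M -> v j = 0) -> dotv M v phi = 0%R.
Proof. by move=> h; apply: big1 => j _; rewrite h // mul0r. Qed.

Lemma dotv_redm q M v w x (phi : nat -> 'Z_q) : 1 < q ->
  (forall j, j < M -> x j = redm q (v j + w j)) ->
  dotv M x phi = (dotv M v phi + dotv M w phi)%R.
Proof.
move=> q1 h; rewrite /dotv -big_split; apply: eq_bigr => j _ /=.
by rewrite h // redm_natr // natrD mulrDl.
Qed.

Lemma dotv_opp q M v x (phi : nat -> 'Z_q) : 1 < q ->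
  (forall j, j < M -> v j <= q) -> (forall j, j < M -> x j = q - v j) ->
  dotv M x phi = (- dotv M v phi)%R.
Proof.
move=> q1 hv h; rewrite /dotv -sumrN; apply: eq_bigr => j _ /=.
rewrite h // natrB ?hv // [X in (X - _)%R](_ : _ = 0%R) ?sub0r ?mulNr //.
by apply/eqP; rewrite Zq_natr_eq0 ?dvdnn.
Qed.

Lemma dotv_bump q M v x a p (phi : nat -> 'Z_q) : 1 < q -> p < M ->
  x p = redm q (v p + a) -> (forall j, j < M -> j != p -> x j = v j) ->
  dotv M x phi = (dotv M v phi + a%:R * phi p)%R.
Proof.
move=> q1 hp xp hx; rewrite /dotv (bigD1 (Ordinal hp)) //= [in RHS](bigD1 (Ordinal hp)) //=.
rewrite xp redm_natr // natrD mulrDl [RHS]addrAC; congr (_ + _)%R.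
by apply: eq_bigr => j; rewrite -val_eqE => /= hj; rewrite hx.
Qed.

Lemma potential_le q M W : rows_ok q M W -> potential M W <= q * M.
Proof.
move=> h; rewrite mulnC -[M in M * q]card_ord -sum_nat_const; apply: leq_sum => a _.
by have [/ltnW] := h a (ltn_ord a).
Qed.

Lemma eq_potential M W W' : (forall a, a < M -> W a a = W' a a) -> potential M W = potential M W'.
Proof. by move=> h; apply: eq_bigr => a _; apply: h. Qed.

Lemma potential_lt M W W' r : r < M -> W r r < W' r r ->
  (forall a, a < M -> a != r -> W' a a = W a a) -> potential M W < potential M W'.
Proof.
move=> hr lt_r h; rewrite /potential (bigD1 (Ordinal hr)) //= [X in _ < X](bigD1 (Ordinal hr)) //=.
rewrite [X in _ < _ + X](eq_bigr (fun a : 'I_M => W a a)) ?ltn_add2r // => a.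
by rewrite -val_eqE => /= ha; rewrite h.
Qed.

(** Column number of a block [u] and a word: a base [B] numeral, most significant digit first, with
    [u] as leading part. *)
Definition radix (B u : nat) (ds : seq nat) : nat := foldl (fun a x => a * B + x) u ds.

(** As a function of [j] this is a functional on columns: it strips [d] digits, multiplies their
    values under [g], and vanishes unless the leading part is [u]. *)
Fixpoint decode (E : comNzRingType) (B : nat) (g : nat -> E) (u d j : nat) : E :=
  if d is d'.+1 then (decode B g u d' (j %/ B)%N * g (j %% B)%N)%R else (j == u)%:R%R.

(** Induction on the word from its end, since [decode] strips the last digit first. *)
Lemma decode_radix (E : comNzRingType) B (g : nat -> E) u u' ds :
  all (fun x => x < B) ds ->
  decode B g u (size ds) (radix B u' ds) = ((u' == u)%:R * \prod_(x <- ds) g x)%R.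
Proof.
elim/last_ind: ds => [|ds x IH]; first by rewrite big_nil mulr1.
rewrite all_rcons size_rcons /= => /andP[hx /IH{}IH].
rewrite /radix foldl_rcons -/(radix B u' ds) /=.
have B0 : 0 < B by lia.
rewrite divnMDl // divn_small // addn0 modnMDl modn_small // IH.
by rewrite -cats1 big_cat big_seq1 /= mulrA.
Qed.

Lemma radix_lt B u ds U : all (fun x => x < B) ds -> u < U ->
  radix B u ds < U * B ^ size ds.
Proof.
elim: ds u U => [|x ds IH] u U /=; first by rewrite muln1.
by move=> /andP[hx hds] hu; rewrite expnS mulnA; apply: IH => //; nia.
Qed.

(** * The program *)

Notation run l x := (foldl (fun y op => exec_data op y) x l).

Lemma run_const r c l m i o :
  run (IConst r c :: l) (Data m i o) = run l (Data (upd m r c) i o).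
Proof. by []. Qed.
Lemma run_add r a b l m i o :
  run (IAdd r a b :: l) (Data m i o) = run l (Data (upd m r (m a + m b)) i o).
Proof. by []. Qed.
Lemma run_sub r a b l m i o :
  run (ISub r a b :: l) (Data m i o) = run l (Data (upd m r (m a - m b)) i o).
Proof. by []. Qed.
Lemma run_load r a l m i o :
  run (ILoad r a :: l) (Data m i o) = run l (Data (upd m r (m (m a))) i o).
Proof. by []. Qed.
Lemma run_store r a l m i o :
  run (IStore r a :: l) (Data m i o) = run l (Data (upd m (m r) (m a)) i o).
Proof. by []. Qed.
Lemma run_read r l m i o :
  run (IRead r :: l) (Data m i o) = run l (Data (upd m r (head 0 i)) (behead i) o).
Proof. by []. Qed.
Lemma run_print r l m i o :
  run (IPrint r :: l) (Data m i o) = run l (Data m i (rcons o (m r))).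
Proof. by []. Qed.
Lemma run_nil m i o : run [::] (Data m i o) = Data m i o.
Proof. by []. Qed.

Lemma upd_eq m r v : upd m r v r = v.
Proof. by rewrite /upd eqxx. Qed.
Lemma upd_ne m r v a : a != r -> upd m r v a = m a.
Proof. by rewrite /upd => /negPf ->. Qed.
Arguments upd : simpl never.

(** Symbolic execution: [peel] resolves reads through nested updates, separating addresses by [lia],
    and [sx] runs one instruction. *)
Ltac peel := repeat match goal with
  | |- context [upd ?m ?r ?v ?a] =>
    first [rewrite (upd_eq m r v) | rewrite (@upd_ne m r v a); [|solve [done | lia]]]
  end.
Ltac sx := first [rewrite run_const | rewrite run_add | rewrite run_sub | rewrite run_load
  | rewrite run_store | rewrite run_nil]; peel.

(* Registers: 1, 2, 3, 4 hold the constants 1, 0, q, q-1; 5 is n, 6 is n+1, 7 the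
   number M of columns; 8, 9, 10 are the addresses of the vector, of the table and of
   the output buffer, laid out in this order from address 29+k on; 11 is the end of
   the buffer, 12 the number of kept constraints, 13 of unread ones; 14 flags that the
   current constraint is kept; 15, 16, 17 point to the current entry of the vector, row
   and diagonal entry, and 18 counts the remaining rows (it holds the index of a
   monomial while the vector is built); 19-27 are scratch; 28 holds the address 26;
   29, ..., 28+k hold the variables of the current constraint. *)

(* The two candidates go to registers 26 and 27, and the result is loaded from address
   26 or 27, so that no jump is needed. *)
Definition modred : seq instr :=
  [:: ISub 26 24 3; IAdd 27 24 2; ISub 20 24 4; ISub 20 1 20; IAdd 20 20 28; ILoad 24 20].

Lemma run_modred m i o q l (Q : data -> Prop) :
  m 1 = 1 -> m 2 = 0 -> m 3 = q -> m 4 = q.-1 -> m 28 = 26 -> 0 < q ->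
  (forall m', m' 24 = redm q (m 24) ->
     (forall a, a \notin [:: 20; 24; 26; 27] -> m' a = m a) -> Q (run l (Data m' i o))) ->
  Q (run (modred ++ l) (Data m i o)).
Proof.
move=> h1 h2 h3 h4 h28 q0 HQ.
rewrite cat_cons; do 6 (sx; rewrite ?h1 ?h2 ?h3 ?h4 ?h28).
apply: HQ.
- rewrite upd_eq /redm; case: ifP => hq.
    (* Truncated subtraction serves as comparison: [m 24 - q.-1] is zero exactly when [m 24 < q],
       which selects the unchanged copy at 27 instead of the difference at 26. *)
    have -> : 1 - (m 24 - q.-1) + 26 = 27 by lia.
    by peel; rewrite addn0.
  by have -> : 1 - (m 24 - q.-1) + 26 = 26 by lia; peel.
- by move=> a; rewrite !inE => ha; peel.
Qed.

Definition addcell : seq instr :=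
  [:: ILoad 24 21; ILoad 25 22; IAdd 24 24 25] ++ modred ++
  [:: IStore 21 24; IAdd 21 21 1; IAdd 22 22 1; ISub 23 23 1].
(** Register 21 walks along the vector, 22 along the row whose address is in 16, and 23 counts the
    cells left. *)
Definition rowloop (body : seq instr) : cmd :=
  Seq (Ops [:: IAdd 21 8 2; IAdd 22 16 2; IAdd 23 7 2]) (While 23 (Ops body)).
Definition addrow := rowloop addcell.
Definition storerow := rowloop
  [:: ILoad 24 21; ISub 24 3 24; IStore 22 24; IStore 21 2; IAdd 21 21 1; IAdd 22 22 1;
      ISub 23 23 1].

(** One Horner step on register 18, multiplying by register [cnt] and adding register [r]; the
    product is a repeated addition. *)
Definition mulstep (cnt r : nat) : cmd :=
  Seq (Ops [:: IAdd 25 r 2; IAdd 23 cnt 2])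
      (Seq (While 23 (Ops [:: IAdd 25 25 18; ISub 23 23 1])) (Ops [:: IAdd 18 25 2])).

Record consts (q n M K : nat) (m : nat -> nat) : Prop := Consts {
  const1 : m 1 = 1; const2 : m 2 = 0; const3 : m 3 = q; const4 : m 4 = q.-1;
  const5 : m 5 = n; const6 : m 6 = n.+1; const7 : m 7 = M; const8 : m 8 = K;
  const9 : m 9 = K + M; const10 : m 10 = K + M + M * M; const28 : m 28 = 26 }.

Definition const_regs := [:: 1; 2; 3; 4; 5; 6; 7; 8; 9; 10; 28].

Lemma consts_frame q n M K m m' :
  (forall a, a \in const_regs -> m' a = m a) -> consts q n M K m -> consts q n M K m'.
Proof. by move=> h [*]; split; rewrite h. Qed.

Definition scratch := [:: 0; 20; 21; 22; 23; 24; 25; 26; 27].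

Lemma wp_mulstep cnt r m i o (Q : data -> Prop) :
  m 1 = 1 -> m 2 = 0 -> cnt \notin [:: 0; 18; 23; 25] ->
  (forall m', m' 18 = m 18 * m cnt + m r ->
     (forall a, a \notin [:: 0; 18; 23; 25] -> m' a = m a) -> Q (Data m' i o)) ->
  wp (mulstep cnt r) (6 + m cnt * 3) Q (Data m i o).
Proof.
move=> h1 h2 hcnt HQ; pose I c y := exists m', [/\ y = Data m' i o, m' 23 = c,
  c <= m cnt, m' 25 = m 18 * (m cnt - c) + m r &
  forall a, a \notin [:: 0; 23; 25] -> m' a = m a].
apply: (@wp_time _ (2 + ((3 + m cnt * 3) + 1))); last lia.
have hc : [&& cnt != 0, cnt != 23 & cnt != 25] by move: hcnt; rewrite !inE; lia.
apply/wp_seq/wp_ops => //; do 2 (sx; rewrite ?h2 ?addn0); rewrite run_nil.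
apply/wp_seq; apply: (@wp_while _ _ _ I).
- move=> c _ [m' [-> m23 le_c m25 fr]] /= lt0c; rewrite m23 in lt0c.
  exists c.-1; first by lia.
  apply: wp_ops => //; do 2 sx; rewrite run_nil.
  eexists; split; first by []; peel.
  + by rewrite m23 fr // h1; lia.
  + by lia.
  + by rewrite m25 fr //; nia.
  + by move=> a; rewrite !inE => ha; peel; rewrite fr // !inE; lia.
- move=> c _ [m' [-> m23 le_c m25 fr]] /=; rewrite m23 => c0; rewrite {}c0 in m25.
  apply: wp_ops => //; sx; rewrite run_nil; apply: HQ; peel.
  + by rewrite m25 fr // h2; nia.
  + by move=> a; rewrite !inE => ha; peel; rewrite fr // !inE; lia.
- rewrite /=; eexists; split; first by []; peel => //.
  + by rewrite subnn muln0.
  + by move=> a; rewrite !inE => ha; peel.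
Qed.

Lemma wp_addrow q n M K w m i o (Q : data -> Prop) :
  consts q n M K m -> 0 < q -> 28 < K -> m 16 = w -> K + M <= w ->
  (forall m', (forall j, j < M -> m' (K + j) = redm q (m (K + j) + m (w + j))) ->
     (forall a, a \notin scratch -> ~~ (K <= a < K + M) -> m' a = m a) -> Q (Data m' i o)) ->
  wp addrow (6 + M * 14) Q (Data m i o).
Proof.
move=> hc q0 hK hw hKw HQ; case: (hc) => h1 h2 h3 h4 h5 h6 h7 h8 h9 h10 h28.
(* With [c] cells left, the first [M - c] are updated, and the frame clause keeps the later ones at
   their original values. The row lies beyond the vector and is not overwritten. *)
pose I c y := exists m', [/\ y = Data m' i o,
  [/\ m' 23 = c, c <= M, m' 21 = K + (M - c) & m' 22 = w + (M - c)],
  (forall j, j < M - c -> m' (K + j) = redm q (m (K + j) + m (w + j))) &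
  forall a, a \notin scratch -> ~~ (K <= a < K + (M - c)) -> m' a = m a].
apply: (@wp_time _ (3 + (3 + M * 14))); last lia.
apply/wp_seq/wp_ops => //; do 3 (sx; rewrite ?h2 ?h8 ?h7 ?hw ?addn0); rewrite run_nil.
apply: (@wp_while _ _ _ I).
- move=> c _ [m' [-> [m23 le_c m21 m22] mV fr]] /= lt0c; rewrite m23 in lt0c.
  exists c.-1; first by lia.
  have notS a : 28 < a -> a \notin scratch by rewrite !inE; lia.
  have frK j : M - c <= j -> m' (K + j) = m (K + j) by move=> hj; rewrite fr ?notS //; lia.
  have frw j : m' (w + j) = m (w + j) by rewrite fr ?notS //; lia.
  apply: (@wp_time _ (size addcell)) => //; apply: wp_ops => //.
  rewrite /addcell; do 3 sx.
  have fr0 a : a \notin scratch -> a < 29 -> m' a = m a by move=> h h'; rewrite fr //; lia.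
  rewrite m21 m22 frK // frw.
  apply: (@run_modred _ _ _ q); peel; rewrite ?fr0 // => m'' m''24 fr'.
  do 4 (sx; rewrite ?(fr' 21) ?(fr' 22) ?(fr' 23) ?(fr' 1) //; peel); rewrite run_nil.
  rewrite m21 m22 m23 fr0 // h1 m''24.
  eexists; split; first by []; peel.
  + by split; lia.
  + move=> j hj; case: (eqVneq j (M - c)) => [->|ne]; peel => //.
    rewrite fr'; last by rewrite !inE; lia.
    by peel; rewrite mV //; lia.
  + move=> a ha ha'; move: (ha); rewrite !inE => hs; peel; rewrite fr'; last by rewrite !inE; lia.
    by peel; rewrite fr //; lia.
- by move=> c _ [m' [-> [m23 le_c m21 m22] mV fr]] /=; rewrite m23 => c0;
    rewrite {}c0 subn0 in mV fr; apply: HQ.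
- rewrite /=; eexists; split; first by []; peel.
  + by split; lia.
  + by move=> j; rewrite subnn.
  + by move=> a; rewrite !inE => ha _; peel.
Qed.

Lemma wp_storerow q n M K w m i o (Q : data -> Prop) :
  consts q n M K m -> 28 < K -> m 16 = w -> K + M <= w ->
  (forall m', (forall j, j < M -> m' (K + j) = 0) ->
     (forall j, j < M -> m' (w + j) = q - m (K + j)) ->
     (forall a, a \notin scratch -> ~~ (K <= a < K + M) -> ~~ (w <= a < w + M) -> m' a = m a) ->
     Q (Data m' i o)) ->
  wp storerow (6 + M * 8) Q (Data m i o).
Proof.
move=> hc hK hw hKw HQ; case: (hc) => h1 h2 h3 h4 h5 h6 h7 h8 h9 h10 h28.
pose I c y := exists m', [/\ y = Data m' i o,
  [/\ m' 23 = c, c <= M, m' 21 = K + (M - c) & m' 22 = w + (M - c)],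
  (forall j, j < M - c -> m' (K + j) = 0), (forall j, j < M - c -> m' (w + j) = q - m (K + j)) &
  forall a, a \notin scratch -> ~~ (K <= a < K + (M - c)) ->
    ~~ (w <= a < w + (M - c)) -> m' a = m a].
apply: (@wp_time _ (3 + (3 + M * 8))); last lia.
apply/wp_seq/wp_ops => //; do 3 (sx; rewrite ?h2 ?h8 ?h7 ?hw ?addn0); rewrite run_nil.
apply: (@wp_while _ _ _ I).
- move=> c _ [m' [-> [m23 le_c m21 m22] mV mW fr]] /= lt0c; rewrite m23 in lt0c.
  exists c.-1; first by lia.
  have notS a : 28 < a -> a \notin scratch by rewrite !inE; lia.
  have fr0 a : a \notin scratch -> a < 29 -> m' a = m a by move=> h h'; rewrite fr //; lia.
  apply: (@wp_time _ 7) => //; apply: wp_ops => //.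
  do 7 (sx; rewrite ?m21 ?m22 ?m23 ?(fr0 1) ?(fr0 2) ?(fr0 3) ?h1 ?h2 ?h3 //; peel).
  rewrite run_nil.
  rewrite (fr (K + (M - c))) ?notS //; try lia.
  eexists; split; first by []; peel.
  + by split; lia.
  + move=> j hj; case: (eqVneq j (M - c)) => [->|ne]; peel => //.
    by rewrite mV //; lia.
  + move=> j hj; case: (eqVneq j (M - c)) => [->|ne]; peel => //.
    by rewrite mW //; lia.
  + by move=> a ha ha' ha''; move: (ha); rewrite !inE => hs; peel; rewrite fr //; lia.
- by move=> c _ [m' [-> [m23 le_c m21 m22] mV mW fr]] /=; rewrite m23 => c0;
    rewrite {}c0 subn0 in mV mW fr; apply: HQ.
- rewrite /=; eexists; split; first by []; peel.
  + by split; lia.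
  + by move=> j; rewrite subnn.
  + by move=> j; rewrite subnn.
  + by move=> a; rewrite !inE => ha _ _; peel.
Qed.

(** * Reducing a vector against the table *)

Definition Vof K (m : nat -> nat) (j : nat) : nat := m (K + j).
Definition Wof K M (m : nat -> nat) (a b : nat) : nat := m (K + M + a * M + b).

Lemma cell_lt M a b : a < M -> b < M -> a * M + b < M * M.
Proof. nia. Qed.

Lemma row_disjoint M a a' b : a != a' -> b < M -> ~~ (a' * M <= a * M + b < a' * M + M).
Proof.
move=> ne hb; apply/negP => /andP[h1 h2].
have : a < a' \/ a' < a by lia.
by case=> h; nia.
Qed.

(** Subtracting [q.-1] leaves register 19 positive exactly when adding row [i] makes entry [i] reach
    [q] and wrap around. *)
Definition pivot_test : seq instr := [:: ILoad 19 15; ILoad 20 17; IAdd 19 19 20; ISub 19 19 4].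
Definition reduce_row : cmd := Seq (Ops pivot_test) (While 19 (Seq addrow (Ops pivot_test))).
Definition finish_row : cmd :=
  Seq (Ops [:: ILoad 19 15]) (While 19 (Seq storerow (Ops [:: IConst 14 1; IConst 19 0]))).
Definition reduce : cmd :=
  Seq (Ops [:: IAdd 15 8 2; IAdd 16 9 2; IAdd 17 9 2; IAdd 18 7 2; IConst 14 0])
    (While 18 (Seq reduce_row (Seq finish_row
       (Ops [:: IAdd 15 15 1; IAdd 16 16 7; IAdd 17 17 7; IAdd 17 17 1; ISub 18 18 1])))).

(** Each wraparound strictly lowers entry [i], because [W i i < q]; so the value of that entry
    bounds the number of rounds. A functional that kills row [i] does not notice the additions. *)
Lemma wp_reduce_row q n M K i m inp out (Q : data -> Prop) :
  let V := Vof K m in let W := Wof K M m in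
  consts q n M K m -> 1 < q -> 28 < K -> i < M ->
  m 15 = K + i -> m 16 = K + M + i * M -> m 17 = K + M + i * M + i ->
  rows_ok q M W -> (forall j, j < M -> V j < q) -> (forall j, j < i -> V j = 0) ->
  (forall m', (forall j, j < M -> Vof K m' j < q) -> (forall j, j < i -> Vof K m' j = 0) ->
     Vof K m' i + W i i < q ->
     (forall phi, dotv M (W i) phi = 0%R :> 'Z_q -> dotv M (Vof K m') phi = dotv M V phi) ->
     ((forall j, j < M -> V j = 0) -> (forall j, j < M -> Vof K m' j = 0)) ->
     (forall a, a \notin 19 :: scratch -> ~~ (K <= a < K + M) -> m' a = m a) ->
     Q (Data m' inp out)) ->
  wp reduce_row (7 + q * (11 + M * 14)) Q (Data m inp out).
Proof.
move=> V W hc q1 hK iM h15 h16 h17 okW Vlt V0 HQ; case: (hc) => h1 h2 h3 h4 h5 h6 h7 h8 h9 h10 h28.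
have [Wii Wle W0] := okW i iM.
pose I c y := exists m', [/\ y = Data m' inp out,
  m' 19 = Vof K m' i + W i i - q.-1 /\ Vof K m' i <= c,
  (forall j, j < M -> Vof K m' j < q) /\ (forall j, j < i -> Vof K m' j = 0),
  (forall phi, dotv M (W i) phi = 0%R :> 'Z_q -> dotv M (Vof K m') phi = dotv M V phi) /\
  ((forall j, j < M -> V j = 0) -> (forall j, j < M -> Vof K m' j = 0)) &
  forall a, a \notin 19 :: scratch -> ~~ (K <= a < K + M) -> m' a = m a].
apply: (@wp_time _ (4 + (3 + q * (6 + M * 14 + 4).+1))); last lia.
have wE j : K + M + i * M + j = K + (M + i * M + j) by lia.
apply/wp_seq/wp_ops => //; do 4 (sx; rewrite ?h15 ?h17 ?h4); rewrite run_nil.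
apply: (@wp_while _ _ _ I).
- move=> c _ [m' [-> [m19 le_c] [Vlt' V0'] [Vphi Vz] fr]] /=; rewrite m19 => lt0.
  have ge_q : q <= Vof K m' i + W i i by lia.
  exists c.-1; first by lia.
  have fr0 a : a \notin 19 :: scratch -> a < 29 -> m' a = m a by move=> h h'; rewrite fr //; lia.
  have frW a : K + M <= a -> m' a = m a by move=> h; rewrite fr ?inE; lia.
  apply: wp_seq; apply: (@wp_addrow q n M K (K + M + i * M)) => //.
  + by apply: consts_frame hc => a; rewrite !inE => ha; rewrite fr0 ?inE; lia.
  + by lia.
  + by rewrite fr0.
  + by lia.
  move=> m'' addV fr'.
  have fr2 a : a \notin 19 :: scratch -> ~~ (K <= a < K + M) -> m'' a = m a.
    by move=> ha ha'; rewrite fr' ?fr //; move: ha; rewrite !inE; lia.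
  have fr3 a : a \notin 19 :: scratch -> a < 29 -> m'' a = m a.
    by move=> h h'; rewrite fr2 //; lia.
  have VE j : j < M -> Vof K m'' j = redm q (Vof K m' j + W i j).
    by move=> hj; rewrite /Vof addV // (frW (K + M + i * M + j)) //; lia.
  apply: wp_ops => //; do 4 (sx; rewrite ?(fr3 15) ?(fr3 17) ?(fr3 4) ?h15 ?h17 ?h4 //; peel).
  rewrite run_nil.
  have peelV j : Vof K (upd (upd m'' 20 (m'' (K + M + i * M + i))) 19
     (m'' (K + i) + m'' (K + M + i * M + i) - q.-1)) j = Vof K m'' j.
    by rewrite /Vof; peel.
  have -> : m'' (K + M + i * M + i) = W i i.
    by rewrite fr2 //; [rewrite !inE; lia | lia].
  eexists; split; first by []; rewrite /Vof; peel.
  + split=> //; have := VE _ iM; rewrite /Vof => ->; move: ge_q le_c.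
    by rewrite /redm /Vof; case: ifP; lia.
  + split=> j hj; peel.
      have := VE j hj; rewrite /Vof => ->; apply: redm_lt.
      by have := Vlt' j hj; have := Wle j hj; rewrite /Vof; lia.
    have hjM : j < M by lia.
    have := VE j hjM; rewrite /Vof => ->; have := V0' j hj; rewrite /Vof => ->.
    (* Before the diagonal the row contains only 0 and [q], and adding either keeps a zero entry
       zero after reduction. *)
    by case: (W0 _ hj) => ->; rewrite /redm; case: ifP; lia.
  + split=> [phi hphi|Vall].
      rewrite (@eq_dotv _ _ _ (Vof K m'')); last by move=> j hj; rewrite /Vof; peel.
      by rewrite (dotv_redm (w := W i) phi q1 VE) Vphi // hphi addr0.
    (* A zero vector never enters the loop: [W i i] alone does not reach [q]. *)
    by have := Vz Vall i iM; lia.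
  + by move=> a ha ha'; move: (ha); rewrite !inE => hs; peel; rewrite fr2.
- move=> c _ [m' [-> [m19 le_c] [Vlt' V0'] [Vphi Vz] fr]] /=; rewrite m19 => lt0.
  by apply: HQ => //; lia.
- rewrite /=; eexists; split; first by []; rewrite /Vof; peel.
  + by split=> //; apply/ltnW/Vlt.
  + by split=> j hj; peel; [apply: Vlt | apply: V0].
  + split=> [phi _|hV j hj]; last by peel; apply: hV.
    by apply: eq_dotv => j hj; peel.
  + by move=> a; rewrite !inE => ha _; peel.
Qed.

Lemma wp_finish_row q n M K i m inp out (Q : data -> Prop) :
  consts q n M K m -> 28 < K -> i < M -> m 15 = K + i -> m 16 = K + M + i * M ->
  (forall m', Vof K m i = 0 -> (forall a, a \notin [:: 0; 19] -> m' a = m a) ->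
     Q (Data m' inp out)) ->
  (forall m', 0 < Vof K m i -> m' 14 = 1 -> (forall j, j < M -> Vof K m' j = 0) ->
     (forall j, j < M -> Wof K M m' i j = q - Vof K m j) ->
     (forall a b, a < M -> b < M -> a != i -> Wof K M m' a b = Wof K M m a b) ->
     (forall a, a \notin 14 :: 19 :: scratch -> a < K \/ K + M + M * M <= a -> m' a = m a) ->
     Q (Data m' inp out)) ->
  wp finish_row (13 + M * 8) Q (Data m inp out).
Proof.
move=> hc hK iM h15 h16 HQ0 HQ1; case: (hc) => h1 h2 h3 h4 h5 h6 h7 h8 h9 h10 h28.
apply: (@wp_time _ (1 + (4 + (6 + M * 8 + 2)))); last lia.
apply/wp_seq/wp_ops => //; sx; rewrite h15 run_nil; apply: wp_when => [//|/=|/=].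
  by peel => v0; apply: HQ0 => // a; rewrite !inE => ha; peel.
peel => lt0.
set m1 := upd (upd m 19 _) 0 1.
have fr a : a \notin [:: 0; 19] -> m1 a = m a by rewrite !inE /m1 => ha; peel.
apply: wp_seq; apply: (@wp_storerow q n M K (K + M + i * M)) => //; first by lia.
move=> m2 sV sW fr'.
apply: wp_ops => //; do 2 sx; rewrite run_nil; split; first by rewrite /=; peel.
have ltMM := cell_lt iM.
apply: HQ1 => //; rewrite /Vof /Wof; peel => //.
- by move=> j hj; peel; rewrite sV.
- by move=> j hj; peel; rewrite sW // fr // !inE; lia.
- move=> a b ha hb ne; peel.
  have h1' := row_disjoint ne hb; have h2' := cell_lt ha hb.
  by rewrite fr' ?fr // ?inE; lia.
- move=> a; rewrite !inE => ha ha'; peel.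
  have lt_iM : i * M + M <= M * M by nia.
  by rewrite fr' ?fr // ?inE; lia.
Qed.

Definition work_regs := [:: 14; 15; 16; 17; 18; 19] ++ scratch.

(** [f] is the flag of register 14. The implications go one way: a replaced row is lost, so
    functionals killing [W'] need not kill [W]. *)
Definition reduced q M V W W' f : Prop :=
  (f = 0 /\ (forall phi : nat -> 'Z_q, annih M W phi -> annih M W' phi /\ dotv M V phi = 0%R) /\
     potential M W <= potential M W') \/
  (f = 1 /\ (forall phi : nat -> 'Z_q, annih M W phi -> dotv M V phi = 0%R -> annih M W' phi) /\
     potential M W < potential M W').

Lemma eq_rows_ok q M W W' : (forall a b, a < M -> b < M -> W' a b = W a b) ->
  rows_ok q M W -> rows_ok q M W'.
Proof.
move=> h ok a ha; have [h1 h2 h3] := ok a ha; split=> [|b hb|b hb]; rewrite h //.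
- exact: h2.
- exact: h3.
- exact: ltn_trans hb ha.
Qed.

Lemma eq_annih q M W W' (phi : nat -> 'Z_q) :
  (forall a b, a < M -> b < M -> W' a b = W a b) -> annih M W phi -> annih M W' phi.
Proof.
by move=> h hW a ha; rewrite -(hW a ha); apply: eq_dotv => b hb; apply: h.
Qed.

Lemma wp_reduce q n M K m inp out (Q : data -> Prop) :
  let V := Vof K m in let W := Wof K M m in
  consts q n M K m -> 1 < q -> 28 < K -> rows_ok q M W -> (forall j, j < M -> V j < q) ->
  (forall m', (forall j, j < M -> Vof K m' j = 0) -> rows_ok q M (Wof K M m') ->
     reduced q M V W (Wof K M m') (m' 14) ->
     (forall a, a \notin work_regs -> a < K \/ K + M + M * M <= a -> m' a = m a) ->
     Q (Data m' inp out)) ->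
  wp reduce (8 + M * (26 + q * (11 + M * 14) + M * 8)) Q (Data m inp out).
Proof.
move=> V W hc q1 hK okW Vlt HQ; case: (hc) => h1 h2 h3 h4 h5 h6 h7 h8 h9 h10 h28.
(* Before column [i], either no row has been replaced and the vector has its original value under
   every functional killing the table, or one has been replaced and the vector is already zero. *)
pose J i m' := [/\ (forall j, j < M -> Vof K m' j < q),
  (forall j, j < i -> Vof K m' j = 0), rows_ok q M (Wof K M m'),
  (m' 14 = 0 /\ (forall phi : nat -> 'Z_q, annih M W phi ->
      annih M (Wof K M m') phi /\ dotv M (Vof K m') phi = dotv M V phi) /\
    potential M W <= potential M (Wof K M m')) \/
  (m' 14 = 1 /\ (forall j, j < M -> Vof K m' j = 0) /\
   (forall phi : nat -> 'Z_q, annih M W phi -> dotv M V phi = 0%R -> annih M (Wof K M m') phi) /\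
    potential M W < potential M (Wof K M m')) &
  (forall a, a \notin work_regs -> a < K \/ K + M + M * M <= a -> m' a = m a)].
pose I c y := exists m', [/\ y = Data m' inp out,
  [/\ m' 18 = c, c <= M, m' 15 = K + (M - c), m' 16 = K + M + (M - c) * M
    & m' 17 = K + M + (M - c) * M + (M - c)] & J (M - c) m'].
have JE i m1 m2 : (forall a, a \in 14 :: iota K (M + M * M) -> m2 a = m1 a) ->
    (forall a, a \notin work_regs -> a < K \/ K + M + M * M <= a -> m2 a = m1 a) ->
    i <= M -> J i m1 -> J i m2.
  move=> h fr le_iM [J1 J2 J3 J4 J5].
  have hV j : j < M -> Vof K m2 j = Vof K m1 j.
    by move=> hj; rewrite /Vof h // inE mem_iota; lia.
  have hW a b : a < M -> b < M -> Wof K M m2 a b = Wof K M m1 a b.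
    by move=> ha hb; have hc' := cell_lt ha hb; rewrite /Wof h // inE mem_iota; lia.
  have h14 : m2 14 = m1 14 by rewrite h // inE.
  have hpot : potential M (Wof K M m2) = potential M (Wof K M m1).
    by apply: eq_potential => a ha; apply: hW.
  split=> [j hj|j hj||| a ha ha']; rewrite ?hV //; try lia.
  - exact: J1.
  - exact: J2.
  - exact: eq_rows_ok J3.
  - rewrite h14 hpot; case: J4 => [[-> [J4 J4']]|[-> [J4 [J4' J4'']]]]; [left|right].
      split=> //; split=> // phi hphi; have [ha hv] := J4 phi hphi.
      by split; [apply: eq_annih ha | rewrite -hv; apply: eq_dotv].
    split=> //; split=> [j hj|]; first by rewrite hV ?J4.
    by split=> // phi hphi hv; apply: eq_annih (J4' phi hphi hv).
  - by rewrite fr ?J5.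
apply: (@wp_time _ (5 + (3 + M * (7 + q * (11 + M * 14) + (13 + M * 8 + 5)).+1))); last lia.
apply/wp_seq/wp_ops => //; do 5 (sx; rewrite ?h8 ?h9 ?h7 ?h2 ?addn0); rewrite run_nil.
apply: (@wp_while _ _ _ I).
- move=> c _ [m' [-> [m18 le_c m15 m16 m17] [J1 J2 J3 J4 J5]]] /=; rewrite m18 => lt0.
  exists c.-1; first by lia.
  have hc' : consts q n M K m'.
    by apply: consts_frame hc => a; rewrite !inE => ha; rewrite J5 ?inE; lia.
  set i := M - c in m15 m16 m17 J1 J2.
  have iM : i < M by rewrite /i; lia.
  apply: wp_seq; apply: (@wp_reduce_row q n M K i) => //.
  move=> m1 V1lt V10 Vi V1phi V1z fr1.
  have fr1' a : a \notin 19 :: scratch -> a < 29 -> m1 a = m' a.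
    by move=> h h'; rewrite fr1 //; lia.
  have W1E a b : Wof K M m1 a b = Wof K M m' a b by rewrite /Wof fr1 ?inE; lia.
  have hc1 : consts q n M K m1.
    by apply: consts_frame hc' => a; rewrite !inE => ha; rewrite fr1' ?inE; lia.
  have J' : J i m1.
    split=> //.
    + by apply: eq_rows_ok J3 => a b _ _; rewrite W1E.
    + have hpot : potential M (Wof K M m1) = potential M (Wof K M m').
        by apply: eq_potential => a ha; apply: W1E.
      rewrite fr1' // hpot; case: J4 => [[-> [J4 J4']]|[-> [J4 [J4' J4'']]]]; [left|right].
        split=> //; split=> // phi hphi; have [ha hv] := J4 phi hphi.
        split; first by apply: eq_annih ha => a b _ _; apply: W1E.
        by rewrite -hv V1phi // ha.
      split=> //; split; first exact: V1z.
      split=> // phi hphi hv; apply: eq_annih (J4' phi hphi hv) => a b _ _; apply: W1E.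
    + move=> a ha ha'; move: (ha); rewrite !inE => hs.
      by rewrite fr1 ?J5 ?inE //; lia.
  apply: wp_seq.
  (* Both outcomes of [finish_row] end with the same increments; register 17 moves by [M + 1] to
     follow the diagonal. *)
  have adv m2 : consts q n M K m2 -> m2 18 = c -> m2 15 = K + i -> m2 16 = K + M + i * M ->
      m2 17 = K + M + i * M + i -> J i.+1 m2 ->
      wp (Ops [:: IAdd 15 15 1; IAdd 16 16 7; IAdd 17 17 7; IAdd 17 17 1; ISub 18 18 1]) 5
        (I c.-1) (Data m2 inp out).
    move=> [g1 g2 _ _ _ _ g7 _ _ _ _] g18 g15 g16 g17 J2'.
    apply: (@wp_time _ 5) => //; apply: wp_ops => //.
    do 5 (sx; rewrite ?g1 ?g7 ?g18 ?g15 ?g16 ?g17); rewrite run_nil.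
    have Ei : M - c.-1 = i.+1 by rewrite /i; lia.
    eexists; split; first by [].
    + by rewrite Ei; split; peel; rewrite ?mulSn; lia.
    + rewrite Ei; apply: JE J2' => [a| a|] //.
        by rewrite inE mem_iota => ha; peel.
      by rewrite !inE => ha _; peel.
  apply: (@wp_finish_row q n M K i) => //; rewrite ?fr1' //.
  + move=> m2 v0 fr2.
    apply: adv; rewrite ?fr2 ?fr1' //.
      by apply: consts_frame hc1 => a; rewrite !inE => ha; rewrite fr2 ?inE; lia.
    apply: (@JE _ m1) => //.
    * by move=> a; rewrite inE mem_iota => ha; rewrite fr2 // !inE; lia.
    * by move=> a; rewrite !inE => ha _; rewrite fr2 // !inE; lia.
    * case: J' => A1 A2 A3 A4 A5; split=> // j; rewrite ltnS leq_eqVlt => /orP[/eqP -> //|].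
      exact: A2.
  + move=> m2 vpos f1 V2 W2 W2' fr2.
    have fr2' a : a \notin 14 :: 19 :: scratch -> a < 29 -> m2 a = m1 a.
      by move=> h h'; rewrite fr2 //; left; lia.
    case: J' => A1 A2 A3 A4 A5.
    (* A second replacement is impossible: the first one left the vector zero, against [vpos]. *)
    case: A4 => [[B1 [B2 B3]]|[B1 [B2 _]]]; last by rewrite B2 in vpos.
    have [okii okle ok0] := A3 i iM.
    apply: adv; rewrite ?fr2' ?fr1' //.
      by apply: consts_frame hc1 => a; rewrite !inE => ha; rewrite fr2' ?inE; lia.
    have W2i b : b < M -> Wof K M m2 i b = q - Vof K m1 b by apply: W2.
    split.
    * by move=> j hj; rewrite V2 //; lia.
    * by move=> j hj; rewrite V2 //; lia.
    * move=> a ha; have [->|ne] := eqVneq a i.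
        split=> [|b hb|b hb]; rewrite W2i //; try lia.
        (* The negative of a zero entry is stored as [q]. *)
        by right; rewrite A2 ?subn0.
      have [o1 o2 o3] := A3 a ha; split=> [|b hb|b hb]; rewrite W2' //; try lia.
      - exact: o2.
      - exact: o3.
    * right; split=> //; split=> //; split.
        move=> phi hphi hv; have [an1 an2] := B2 phi hphi => a ha.
        have [->|ne] := eqVneq a i.
          rewrite (@dotv_opp _ _ (Vof K m1)) ?an2 ?hv ?oppr0 //.
          by move=> j hj; apply/ltnW/A1.
        by rewrite -(an1 a ha); apply: eq_dotv => b hb; apply: W2'.
      apply: leq_ltn_trans B3 _; apply: (@potential_lt _ _ _ i) => //.
        (* The reduction stopped with the sum of vector entry [i] and the old diagonal entry below
           [q], so the new diagonal entry, [q] minus the former, exceeds the old one. *)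
        by rewrite W2i //; move: Vi; rewrite -(W1E i i); lia.
      by move=> a ha ne; apply: W2'.
    * move=> a ha ha'; move: (ha); rewrite !inE => hs.
      by rewrite fr2 ?A5 // !inE; lia.
- move=> c _ [m' [-> [m18 le_c m15 m16 m17] [J1 J2 J3 J4 J5]]] /=; rewrite m18 => c0.
  rewrite c0 subn0 in J2; apply: HQ => //.
  case: J4 => [[-> [J4 J4']]|[-> [J4 [J4' J4'']]]]; [left|right]; split=> //; split=> // phi hphi.
  have [an v] := J4 phi hphi; split=> //.
  by rewrite -v; apply: dotv0.
- rewrite /=; eexists; split; first by [].
  + by split; peel; lia.
  + rewrite subnn; apply: (@JE _ (upd m 14 0)) => //.
    * by move=> a; rewrite inE mem_iota => ha; case: (eqVneq a 14) => [->|ne]; peel.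
    * by move=> a; rewrite !inE => ha _; peel.
    have VE j : Vof K (upd m 14 0) j = V j by rewrite /Vof; peel.
    have WE a b : Wof K M (upd m 14 0) a b = W a b by rewrite /Wof; peel.
    split=> //.
    * by move=> j hj; rewrite VE Vlt.
    * by apply: eq_rows_ok okW => a b _ _; apply: WE.
    * left; peel; split=> //; split.
        by move=> phi hphi; split; [apply: eq_annih hphi => a b _ _; apply: WE | apply: eq_dotv].
      by rewrite (eq_potential (W' := W)).
    * by move=> a; rewrite !inE => ha _; peel.
Qed.

(** * The vector of a constraint *)

Notation term k := (nat * nat * seq (option 'I_k))%type.

(** Register 5 holds [n], which serves as the digit of the constant 1 beside the variable indices
    below [n]; hence the base [n.+1]. *)
Definition dreg k (o : option 'I_k) : nat := if o is Some i then 29 + i else 5.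

(** The words are fixed with the program, so Horner's rule is unrolled in its text. *)
Definition digits_code k (w : seq (option 'I_k)) : cmd :=
  foldr (fun o c => Seq (mulstep 6 (dreg o)) c) (Ops [::]) w.

Definition term_code k (t : term k) : cmd :=
  Seq (Ops [:: IConst 18 t.1.1]) (Seq (digits_code t.2)
    (Ops ([:: IAdd 21 18 8; ILoad 24 21; IConst 25 t.1.2; IAdd 24 24 25] ++ modred ++
          [:: IStore 21 24]))).

Definition terms_code k (ts : seq (term k)) : cmd :=
  foldr (fun t c => Seq (term_code t) c) (Ops [::]) ts.

Definition term_index B k (dg : option 'I_k -> nat) (t : term k) : nat :=
  radix B t.1.1 [seq dg o | o <- t.2].

(** The value of [phi] on the vector of a constraint with digits [dg]. It is a sum over terms rather
    than columns, since several terms may share a column. *)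
Definition functional q B k (ts : seq (term k)) (dg : option 'I_k -> nat)
    (phi : nat -> 'Z_q) : 'Z_q :=
  (\sum_(t <- ts) t.1.2%:R * phi (term_index B dg t))%R.

Lemma wp_digits k (w : seq (option 'I_k)) B dg m i o (Q : data -> Prop) :
  m 1 = 1 -> m 2 = 0 -> m 6 = B -> (forall x : option 'I_k, m (dreg x) = dg x) ->
  (forall m', m' 18 = radix B (m 18) [seq dg x | x <- w] ->
     (forall a, a \notin [:: 0; 18; 23; 25] -> m' a = m a) -> Q (Data m' i o)) ->
  wp (digits_code w) (size w * (6 + B * 3)) Q (Data m i o).
Proof.
elim: w m => [|x w IH] m h1 h2 h6 hdg HQ.
  by apply: (@wp_time _ 0) => //; apply: wp_ops => //; apply: HQ.
rewrite mulSn; apply: wp_seq; rewrite -h6; apply: wp_mulstep => // m' m18 fr; rewrite h6.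
have dregN y : dreg y \notin [:: 0; 18; 23; 25].
  by case: y => [y|] //; rewrite /dreg !inE; lia.
apply: IH; try by rewrite fr.
  by move=> y; rewrite fr.
move=> m'' m''18 fr'.
apply: HQ => [|a ha]; last by rewrite fr' ?fr.
by rewrite m''18 m18 h6 hdg.
Qed.

Lemma wp_term k q n M K (t : term k) dg m i o (Q : data -> Prop) :
  consts q n M K m -> 1 < q -> 28 < K -> (forall x : option 'I_k, m (dreg x) = dg x) ->
  term_index n.+1 dg t < M -> t.1.2 < q -> (forall j, j < M -> Vof K m j < q) ->
  (forall m', (forall j, j < M -> Vof K m' j < q) ->
    (forall phi : nat -> 'Z_q, dotv M (Vof K m') phi =
       (dotv M (Vof K m) phi + t.1.2%:R * phi (term_index n.+1 dg t))%R) ->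
     (forall a, a \notin 18 :: scratch -> ~~ (K <= a < K + M) -> m' a = m a) -> Q (Data m' i o)) ->
  wp (term_code t) (12 + size t.2 * (6 + n.+1 * 3)) Q (Data m i o).
Proof.
move=> hc q1 hK hdg hidx ha Vlt HQ; case: (hc) => h1 h2 h3 h4 h5 h6 h7 h8 h9 h10 h28.
apply: (@wp_time _ (1 + (size t.2 * (6 + n.+1 * 3) + 11))); last lia.
apply/wp_seq/wp_ops => //; sx; rewrite run_nil.
apply/wp_seq/(@wp_digits _ _ _ dg); peel => //.
  by move=> x; rewrite -hdg; case: x => [x|]; rewrite /dreg; peel.
move=> m1; set p := term_index n.+1 dg t in hidx HQ *; rewrite -/(term_index n.+1 dg t) -/p.
move=> m18 fr1.
have fr1' a : a \notin [:: 0; 18; 23; 25] -> m1 a = m a.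
  by move=> ha'; rewrite fr1 //; move: ha'; rewrite !inE => ha'; peel.
apply: (@wp_time _ 11) => //; apply: wp_ops => //.
rewrite cat_cons; do 4 (sx; rewrite ?m18 ?(fr1' 8) ?h8 //).
rewrite [p + K]addnC.
have Kp : K + p != 24 by lia.
have mp : m1 (K + p) = m (K + p) by rewrite fr1' // !inE; lia.
rewrite mp.
apply: (@run_modred _ _ _ q); peel; rewrite ?fr1' //; first by lia.
move=> m2 m24 fr2.
sx; rewrite run_nil (fr2 21) //; peel.
have V' j : j < M -> upd m2 (K + p) (m2 24) (K + j) =
     if j == p then redm q (m (K + p) + t.1.2) else m (K + j).
  move=> hj; case: (eqVneq j p) => [->|ne]; peel => //.
  rewrite fr2 ?inE; last by lia.
  by peel; rewrite fr1' // !inE; lia.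
apply: HQ.
- move=> j hj; rewrite /Vof V' //; case: ifP => _; last exact: Vlt.
  by apply: redm_lt; have := Vlt p hidx; rewrite /Vof; lia.
- move=> phi; apply: dotv_bump => //; first by rewrite /Vof V' ?eqxx.
  by move=> j hj ne; rewrite /Vof V' // (negPf ne).
- move=> a; rewrite !inE => ha1 ha2; peel.
  rewrite fr2 ?inE; last by lia.
  by peel; rewrite fr1' // !inE; lia.
Qed.

Definition terms_time n k (ts : seq (term k)) : nat :=
  \sum_(t <- ts) (12 + size t.2 * (6 + n.+1 * 3)).

Lemma wp_terms k q n M (ts : seq (term k)) dg m i o (Q : data -> Prop) :
  let K := 29 + k in
  consts q n M K m -> 1 < q -> (forall x : option 'I_k, m (dreg x) = dg x) ->
  all (fun t : term k => (term_index n.+1 dg t < M) && (t.1.2 < q)) ts ->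
  (forall j, j < M -> Vof K m j < q) ->
  (forall m', (forall j, j < M -> Vof K m' j < q) ->
     (forall phi : nat -> 'Z_q, dotv M (Vof K m') phi =
       (dotv M (Vof K m) phi + functional n.+1 ts dg phi)%R) ->
     (forall a, a \notin 18 :: scratch -> ~~ (K <= a < K + M) -> m' a = m a) -> Q (Data m' i o)) ->
  wp (terms_code ts) (terms_time n ts) Q (Data m i o).
Proof.
move=> K hc q1; elim: ts m hc => [|t ts IH] m hc hdg hts Vlt HQ.
  rewrite /terms_time big_nil; apply: (@wp_time _ 0) => //; apply: wp_ops => //.
  by apply: HQ => // phi; rewrite /functional big_nil addr0.
rewrite /terms_time big_cons; apply: wp_seq.
move: hts => /= /andP[/andP[hidx ha] hts].
apply: (@wp_term _ q n M K t dg) => // m1 V1 phi1 fr1.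
have fr1' a : a < K -> a \notin 18 :: scratch -> m1 a = m a.
  by move=> h h'; apply: fr1 => //; lia.
apply: IH => //.
- by apply: consts_frame hc => a; rewrite !inE => ha'; rewrite fr1' ?inE /K; lia.
- move=> x; rewrite -hdg fr1' //.
    by case: x => [x|] //=; have := ltn_ord x; rewrite /K; lia.
  by case: x => [x|] //=; rewrite !inE; lia.
move=> m2 V2 phi2 fr2; apply: HQ => //.
- by move=> phi; rewrite phi2 phi1 /functional big_cons addrA.
- by move=> a h h'; rewrite fr2 ?fr1.
Qed.

(** * Reading and storing constraints *)

Lemma run_reads j k (c rest : seq nat) m o (Q : data -> Prop) : size c = k ->
  (forall m', (forall x, x < k -> m' (29 + j + x) = nth 0 c x) ->
     (forall a, ~~ (29 + j <= a < 29 + j + k) -> m' a = m a) -> Q (Data m' rest o)) ->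
  Q (run [seq IRead (29 + x) | x <- iota j k] (Data m (c ++ rest) o)).
Proof.
elim: k j c m => [|k IH] j [|y c] m //=; first by move=> _; apply.
move=> [hc] HQ; apply: (IH j.+1 c) => // m' hm' fr; apply: HQ.
- move=> [|x] hx /=; first by rewrite addn0 fr; [peel | lia].
  by rewrite -hm' ?addSnnS ?addnS.
- move=> a ha; rewrite fr; last by lia.
  by rewrite /= /upd; case: eqP => // ?; lia.
Qed.

Definition save_code k : seq instr :=
  flatten [seq [:: IStore 11 (29 + x); IAdd 11 11 1] | x <- iota 0 k].

Lemma run_save_from j k m i o p (Q : data -> Prop) : m 1 = 1 -> m 11 = p -> 29 + j + k <= p ->
  (forall m', m' 11 = p + k -> (forall x, x < k -> m' (p + x) = m (29 + j + x)) ->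
     (forall a, a != 11 -> ~~ (p <= a < p + k) -> m' a = m a) -> Q (Data m' i o)) ->
  Q (run (flatten [seq [:: IStore 11 (29 + x); IAdd 11 11 1] | x <- iota j k]) (Data m i o)).
Proof.
elim: k j p m => [|k IH] j p m h1 h11 hp HQ.
  by apply: HQ => //; rewrite ?addn0.
rewrite [iota _ _]/= [map _ _]/= [flatten _]/= -/(flatten _).
do 2 (sx; rewrite ?h11 ?h1).
apply: (IH j.+1 (p + 1)); peel => //; first by lia.
move=> m' m11 hm' fr; apply: HQ.
- by rewrite m11; lia.
- move=> [|x] hx.
    by rewrite !addn0 fr; [peel | lia | lia].
  rewrite addnS -addSn -addn1 hm' //; peel.
  by congr (m _); lia.
- by move=> a ha ha'; rewrite fr //; [peel | lia].
Qed.

Definition digit k n (c : constraint k n) (o : option 'I_k) : nat :=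
  if o is Some i then tnth c i else n.

Definition blocks k n (s : seq (constraint k n)) : seq nat :=
  flatten [seq [seq val x | x <- tval c] | c <- s].

Lemma size_blocks k n (s : seq (constraint k n)) : size (blocks s) = k * size s.
Proof.
elim: s => [|c s IH]; first by rewrite muln0.
by rewrite /blocks /= size_cat -/(blocks s) IH size_map size_tuple mulnS.
Qed.

Lemma blocks_rcons k n (s : seq (constraint k n)) c :
  blocks (rcons s c) = blocks s ++ [seq val x | x <- tval c].
Proof. by rewrite /blocks map_rcons flatten_rcons. Qed.

(** * The invariant of the kept constraints *)

Section KeptConstraints.
Context (q k n M : nat) (ts : seq (term k)).

Definition vanishes (sk : seq (constraint k n)) (phi : nat -> 'Z_q) : Prop :=
  forall c, c \in sk -> functional n.+1 ts (digit c) phi = 0%R.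

(** The second clause lets the kept constraints control the table, the third bounds their number,
    and the fourth says that they imply all the constraints read so far. *)
Definition kept_ok (W : nat -> nat -> nat) (s sk : seq (constraint k n)) : Prop :=
  [/\ subseq sk s, forall phi, vanishes sk phi -> annih M W phi, size sk <= potential M W
    & forall c, c \in s -> forall phi, vanishes sk phi -> functional n.+1 ts (digit c) phi = 0%R].

(** The vector of a dropped constraint is killed by whatever kills the table, in particular by what
    vanishes on the kept constraints. A newly kept one is paid for by the rise of the potential. *)
Lemma kept_ok_step W W' V f s sk c :
  kept_ok W s sk -> reduced q M V W W' f ->
  (forall phi : nat -> 'Z_q, dotv M V phi = functional n.+1 ts (digit c) phi) ->
  kept_ok W' (rcons s c) (if f == 0 then sk else rcons sk c).
Proof.
move=> [h1 h2 h3 h4] hf hV; case: hf => [[-> [h5 h6]]|[-> [h5 h6]]] /=; split.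
- by rewrite (subseq_trans h1) // subseq_rcons.
- by move=> phi /h2/h5[].
- exact: leq_trans h6.
- move=> c'; rewrite mem_rcons inE => /orP[/eqP ->|] phi hphi; last exact: h4.
  by rewrite -hV; have [] := h5 phi (h2 _ hphi).
- by rewrite -!cats1 cat_subseq.
- move=> phi hphi; apply: h5; last by rewrite hV; apply: hphi; rewrite mem_rcons mem_head.
  by apply: h2 => c' hc'; apply: hphi; rewrite mem_rcons inE hc' orbT.
- by rewrite size_rcons (leq_ltn_trans h3).
- move=> c'; rewrite mem_rcons inE => /orP[/eqP ->|hc'] phi hphi.
    by apply: hphi; rewrite mem_rcons mem_head.
  by apply: h4 => // c'' hc''; apply: hphi; rewrite mem_rcons inE hc'' orbT.
Qed.

End KeptConstraints.

(** * The complete program *)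

Definition filter_one k (ts : seq (term k)) : cmd :=
  Seq (Ops (ISub 13 13 1 :: [seq IRead (29 + x) | x <- iota 0 k]))
   (Seq (terms_code ts)
     (Seq reduce
       (While 14 (Seq (Ops (save_code k)) (Ops [:: IAdd 12 12 1; IConst 14 0]))))).

Definition print_all : cmd :=
  Seq (Ops [:: IPrint 5; IPrint 12; IAdd 21 10 2; ISub 23 11 10])
    (While 23 (Ops [:: ILoad 24 21; IPrint 24; IAdd 21 21 1; ISub 23 23 1])).

Definition mulpow d : cmd := iter d (Seq (mulstep 6 2)) (Ops [::]).

(** Register 2 is 0, so [mulpow] only multiplies and turns [U] into the number of columns. The last
    [mulstep] adds the table's address to its size, which gives the address of the output buffer. *)
Definition setup k d q U : cmd :=
  Seq (Ops [:: IRead 5; IRead 13; IConst 1 1; IConst 2 0; IConst 3 q; IConst 4 q.-1; IAdd 6 5 1;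
               IConst 8 (29 + k); IConst 28 26; IConst 12 0; IConst 18 U])
   (Seq (mulpow d)
     (Seq (Ops [:: IAdd 7 18 2; IAdd 9 8 7])
       (Seq (mulstep 7 9) (Ops [:: IAdd 10 18 2; IAdd 11 18 2])))).

Definition sparsify k d q U (ts : seq (term k)) : cmd :=
  Seq (setup k d q U) (Seq (While 13 (filter_one ts)) print_all).

Lemma wp_print n q M K L m i o (Q : data -> Prop) :
  consts q n M K m -> m 11 = K + M + M * M + L -> 28 < K ->
  (forall m' i', Q (Data m' i' (o ++ n :: m 12 :: [seq m (K + M + M * M + j) | j <- iota 0 L]))) ->
  wp print_all (7 + L * 5) Q (Data m i o).
Proof.
move=> [h1 h2 h3 h4 h5 h6 h7 h8 h9 h10 h28] h11 hK HQ; set OB := K + M + M * M in h10 h11 HQ.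
pose I c y := exists m' c', [/\ y = Data m' i (o ++ n :: m 12 :: [seq m (OB + j) | j <- iota 0 c']),
  c + c' = L, m' 23 = c /\ m' 21 = OB + c', m' 1 = 1 & forall a, K <= a -> m' a = m a].
apply: (@wp_time _ (4 + (3 + L * 5))); last lia.
apply/wp_seq/wp_ops => //; do 2 rewrite run_print; do 2 (sx; rewrite ?h5 ?h2 ?h10 ?h11 ?addn0).
rewrite run_nil; apply: (@wp_while _ _ _ I).
- move=> c _ [m' [c' [-> cL [m23 m21] m1 fr]]] /=; rewrite m23 => lt0; exists c.-1; first by lia.
  apply: (@wp_time _ 4) => //; apply: wp_ops => //.
  rewrite run_load run_print; peel; do 2 (sx; rewrite ?m21 ?m1 ?m23); rewrite run_nil.
  exists (upd (upd (upd m' 24 (m' (OB + c'))) 21 (OB + c' + 1)) 23 (c - 1)), c'.+1.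
  split; peel => //.
  + by rewrite -[c'.+1]addn1 iotaD map_cat cats1 rcons_cat add0n /= -!rcons_cons fr ?cats1 //; lia.
  + by lia.
  + by lia.
  + by move=> a ha; peel; apply: fr.
- move=> c _ [m' [c' [-> cL [m23 m21] m1 fr]]] /=; rewrite m23 => c0.
  by rewrite c0 add0n in cL; rewrite cL; apply: HQ.
- rewrite /=; eexists; exists 0; split; peel.
  + by rewrite /= -!cats1 -catA.
  + by lia.
  + by split; peel; lia.
  + by peel.
  + by move=> a ha; peel.
Qed.

Lemma wp_mulpow d m i o B (Q : data -> Prop) : m 1 = 1 -> m 2 = 0 -> m 6 = B ->
  (forall m', m' 18 = m 18 * B ^ d ->
     (forall a, a \notin [:: 0; 18; 23; 25] -> m' a = m a) -> Q (Data m' i o)) ->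
  wp (mulpow d) (d * (6 + B * 3)) Q (Data m i o).
Proof.
elim: d m => [|d IH] m h1 h2 h6 HQ.
  by apply: (@wp_time _ 0) => //; apply: wp_ops => //; apply: HQ; rewrite ?muln1.
rewrite mulSn; apply: wp_seq; rewrite -{1}h6; apply: wp_mulstep => // m' m18 fr.
apply: IH; try by rewrite fr.
move=> m'' m''18 fr'; apply: HQ => [|a ha]; last by rewrite fr' ?fr.
by rewrite m''18 m18 h2 h6 addn0 expnS mulnA.
Qed.

Lemma wp_setup k d q U n l inp o (Q : data -> Prop) : 0 < q ->
  let M := U * n.+1 ^ d in let K := 29 + k in
  (forall m, consts q n M K m -> m 13 = l -> m 12 = 0 -> m 11 = K + M + M * M ->
     (forall a, K <= a -> m a = 0) -> Q (Data m inp o)) ->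
  wp (setup k d q U) (21 + d * (6 + n.+1 * 3) + M * 3) Q (Data (fun=> 0) (n :: l :: inp) o).
Proof.
move=> q0 M K HQ.
apply: (@wp_time _ (11 + (d * (6 + n.+1 * 3) + (2 + ((6 + M * 3) + 2))))); last lia.
apply/wp_seq/wp_ops => //; rewrite !run_read ![head _ _]/= ![behead _]/=; do 9 sx.
rewrite run_nil; apply/wp_seq/(@wp_mulpow _ _ _ _ n.+1); peel => //; first by rewrite addn1.
move=> m1 m18 fr1; rewrite -/M in m18.
apply/wp_seq/wp_ops => //; do 2 sx; rewrite run_nil m18.
have g2 : m1 2 = 0 by rewrite fr1 //; peel.
have g1 : m1 1 = 1 by rewrite fr1 //; peel.
have g8 : m1 8 = K by rewrite fr1 //; peel.
rewrite g2 g8 addn0.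
apply: wp_seq; rewrite -{1}[M](@upd_eq m1 7) -(@upd_ne (upd m1 7 M) 9 (K + M) 7) //.
apply: wp_mulstep; peel => // m2 m2_18 fr2.
rewrite (_ : _ + _ = K + M + M * M) in m2_18; last by lia.
apply: wp_ops => //; do 2 sx; rewrite run_nil m2_18 (fr2 2) //; peel; rewrite g2 addn0.
apply: HQ; last 4 first.
- by peel; rewrite fr2 //; peel; rewrite fr1 //; peel.
- by peel; rewrite fr2 //; peel; rewrite fr1 //; peel.
- by peel.
- move=> a; rewrite /K => ha; peel; rewrite fr2 ?inE; last by lia.
  by peel; rewrite fr1 ?inE; [peel | lia].
by split; peel => //; rewrite fr2 //; peel => //; rewrite fr1 //; peel => //; rewrite addn1.
Qed.

(** [s] lists the constraints read so far and [sk] those kept; the vector is zero between rounds. *)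
Record loop_inv q k n M (ts : seq (term k)) (s sk : seq (constraint k n)) (m : nat -> nat) : Prop :=
  LoopInv {
    inv_consts : consts q n M (29 + k) m;
    inv_count : m 12 = size sk;
    inv_out : m 11 = 29 + k + M + M * M + k * size sk;
    inv_blocks : forall j, j < k * size sk -> m (29 + k + M + M * M + j) = nth 0 (blocks sk) j;
    inv_V : forall j, j < M -> Vof (29 + k) m j = 0;
    inv_rows : rows_ok q M (Wof (29 + k) M m);
    inv_kept : kept_ok q M ts (Wof (29 + k) M m) s sk }.

Lemma loop_inv_frame q k n M (ts : seq (term k)) (s sk : seq (constraint k n)) m m' :
  (forall a, a \in [:: 11; 12] ++ const_regs -> m' a = m a) ->
  (forall a, 29 + k <= a -> m' a = m a) ->
  loop_inv q M ts s sk m -> loop_inv q M ts s sk m'.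
Proof.
move=> fr fr' [i1 i2 i3 i4 i5 i6 i7].
have WE a b : Wof (29 + k) M m' a b = Wof (29 + k) M m a b by rewrite /Wof fr' //; lia.
split.
- by apply: consts_frame i1 => a ha; rewrite fr // mem_cat ha orbT.
- by rewrite fr.
- by rewrite fr.
- by move=> j hj; rewrite fr' ?i4 //; lia.
- by move=> j hj; rewrite /Vof fr' ?leq_addr // -/(Vof _ m j) i5.
- by apply: eq_rows_ok i6 => a b _ _.
- case: i7 => h1 h2 h3 h4; split=> //.
    by move=> phi /h2; apply: eq_annih => a b _ _.
  by rewrite (eq_potential (W' := Wof (29 + k) M m)).
Qed.

Definition filter_time q k n M (ts : seq (term k)) : nat :=
  18 + 3 * k + terms_time n ts + M * (26 + q * (11 + M * 14) + M * 8).

Lemma save_code_no_jump k : all (fun op => ~~ is_jump op) (save_code k).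
Proof. by rewrite /save_code; elim: (iota 0 k). Qed.

Lemma wp_filter_one q k n M (ts : seq (term k)) (s sk : seq (constraint k n)) c m inp :
  1 < q ->
  all (fun t : term k => (term_index n.+1 (digit c) t < M) && (t.1.2 < q)) ts ->
  loop_inv q M ts s sk m ->
  wp (filter_one ts) (filter_time q n M ts)
    (fun y => exists m' sk', [/\ y = Data m' inp [::], m' 13 = m 13 - 1
       & loop_inv q M ts (rcons s c) sk' m'])
    (Data m ([seq val x | x <- tval c] ++ inp) [::]).
Proof.
move=> q1 hts [hc m12 m11 mB V0 okW hk].
case: (hc) => h1 h2 h3 h4 h5 h6 h7 h8 h9 h10 h28.
set K := 29 + k in hc m11 mB V0 okW hk h8 h9 h10 *.
have K28 : 28 < K by rewrite /K; lia.
set OB := K + M + M * M in m11 mB h10.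
apply: (@wp_time _ (k.+1 + (terms_time n ts +
  ((8 + M * (26 + q * (11 + M * 14) + M * 8)) + (4 + (k * 2 + 2)))))).
  2: by rewrite /filter_time; lia.
apply: wp_seq.
have -> : k.+1 = size (ISub 13 13 1 :: [seq IRead (29 + x) | x <- iota 0 k]).
  by rewrite /= size_map size_iota.
apply: wp_ops; first by rewrite /= all_map; elim: (iota 0 k).
rewrite run_sub h1.
apply: run_reads; first by rewrite size_map size_tuple.
move=> m1 hX fr1.
have fr1' a : a != 13 -> (a < 29) || (K <= a) -> m1 a = m a.
  by move=> ha ha'; rewrite fr1; [peel | rewrite /K in ha'; lia].
have m1_13 : m1 13 = m 13 - 1 by rewrite fr1 //; peel.
have hdg x : m1 (dreg x) = digit c x.
  case: x => [x|] /=; last by rewrite fr1' ?h5.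
  rewrite -[29]addn0 hX // (nth_map (tnth c x)) ?size_tuple //.
  by rewrite -tnth_nth.
have V1E j : Vof K m1 j = Vof K m j by rewrite /Vof fr1' //; lia.
have W1E a b : Wof K M m1 a b = Wof K M m a b by rewrite /Wof fr1' //; lia.
have hc1 : consts q n M K m1.
  by apply: consts_frame hc => a; rewrite !inE => ha; rewrite fr1' //; lia.
apply: wp_seq; apply: (@wp_terms k q n M ts (digit c)) => //.
  by move=> j hj; rewrite V1E V0 //; lia.
rewrite -/K => m2 V2lt V2 fr2.
have fr2' a : a \notin 18 :: scratch -> a < K -> m2 a = m1 a.
  by move=> h h'; rewrite fr2 //; lia.
have fr2K a : K + M <= a -> m2 a = m a.
  by move=> h; rewrite fr2 ?fr1' ?inE //; lia.
have W2E a b : Wof K M m2 a b = Wof K M m a b by rewrite /Wof fr2K //; lia.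
have hc2 : consts q n M K m2.
  by apply: consts_frame hc1 => a; rewrite !inE => ha; rewrite fr2' ?inE //; lia.
(* The vector was zero before the terms were added, so it now represents exactly [c]. *)
have V2' phi : dotv M (Vof K m2) phi = functional n.+1 ts (digit c) phi :> 'Z_q.
  by rewrite V2 dotv0 ?add0r // => j hj; rewrite V1E V0.
apply: wp_seq; apply: (@wp_reduce q n M K) => //.
  by apply: eq_rows_ok okW => a b _ _.
move=> m3 V3 okW3 red3 fr3.
have fr3' a : a \notin work_regs -> a < K -> m3 a = m1 a.
  move=> h h'; rewrite fr3 ?fr2' //; last by left.
  by move: h; rewrite !inE; lia.
have fr3O a : OB <= a -> m3 a = m a.
  by rewrite /OB => h; rewrite fr3 ?fr2K //; [lia | rewrite !inE; lia | right].
have hc3 : consts q n M K m3.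
  by apply: consts_frame hc1 => a; rewrite !inE => ha; rewrite fr3' ?inE //; lia.
have hk2 : kept_ok q M ts (Wof K M m2) s sk.
  case: hk => g1 g2 g3 g4; split=> //.
    by move=> phi /g2; apply: eq_annih => a b _ _.
  by rewrite (eq_potential (W' := Wof K M m)).
have hk3 := kept_ok_step hk2 red3 V2'.
have m3_12 : m3 12 = size sk by rewrite fr3' ?fr1' //; lia.
have m3_11 : m3 11 = OB + k * size sk by rewrite fr3' ?fr1' //; lia.
have m3_13 : m3 13 = m 13 - 1 by rewrite fr3' //; lia.
have inv3 sk' : sk' = sk -> m3 14 == 0 -> loop_inv q M ts (rcons s c) sk' m3.
  move=> -> f0; rewrite f0 in hk3; split=> //.
  by move=> j hj; rewrite -/K -/OB fr3O ?mB //; lia.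
apply: wp_when => //.
  move=> /= f0; exists (upd m3 0 1), sk; split; [by [] | by peel |].
  apply: (@loop_inv_frame _ _ _ _ _ _ _ m3); last by apply: inv3 => //; apply/eqP.
  - by move=> a; rewrite !inE => ha; peel.
  - by move=> a ha; peel.
rewrite [dmem _ _]/= => fpos.
have fE : (m3 14 == 0) = false by lia.
rewrite fE in hk3.
apply: wp_seq.
have -> : k * 2 = size (save_code k).
  rewrite /save_code size_flatten /shape -map_comp sumnE big_map big_const_seq.
  by rewrite iter_addn_0 count_predT size_iota mulnC.
apply: wp_ops; first exact: save_code_no_jump.
rewrite [exec_data _ _]/=.
apply: (@run_save_from 0 k _ _ _ (OB + k * size sk)); peel => //.
- by case: hc3.
- by rewrite /OB /K; lia.
move=> m4 m4_11 m4X fr4.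
have fr4' a : a != 0 -> a != 11 -> a < OB + k * size sk -> m4 a = m3 a.
  by move=> g1 g2 g3; rewrite fr4 //; [peel | lia].
have hc4 : consts q n M K m4.
  by apply: consts_frame hc3 => a; rewrite !inE => ha; rewrite fr4' //; rewrite /OB; lia.
apply: (@wp_time _ 2) => //; apply: wp_ops => //; do 2 sx; rewrite run_nil.
split; first by rewrite /=; peel.
have [g1 _ _ _ _ _ _ _ _ _ _] := hc4.
have m5_12 : m4 12 + m4 1 = size (rcons sk c).
  by rewrite g1 size_rcons addn1 fr4' ?m3_12 // /OB; lia.
exists (upd (upd m4 12 (m4 12 + m4 1)) 14 0), (rcons sk c); split=> //.
  by peel; rewrite fr4' ?m3_13 // /OB; lia.
have fr5 a : K <= a -> upd (upd m4 12 (m4 12 + m4 1)) 14 0 a = m4 a by move=> ha; peel.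
have WE a b : a < M -> b < M ->
    Wof K M (upd (upd m4 12 (m4 12 + m4 1)) 14 0) a b = Wof K M m3 a b.
  move=> ha hb; have ltMM := cell_lt ha hb.
  by rewrite /Wof fr5 ?fr4' //; rewrite ?/OB; lia.
split.
- by apply: consts_frame hc4 => a; rewrite !inE => ha; peel.
- by peel.
- by peel; rewrite -/K -/OB m4_11 size_rcons mulnS; lia.
- rewrite -/K -/OB size_rcons mulnS blocks_rcons => j hj.
  rewrite fr5 ?/OB; last by lia.
  rewrite nth_cat size_blocks; case: ltnP => hj'.
    by rewrite fr4' ?fr3O ?mB //; rewrite /OB; lia.
  have -> : K + M + M * M + j = OB + k * size sk + (j - k * size sk) by rewrite /OB; lia.
  have hjk : j - k * size sk < k by lia.
  have notw : 29 + 0 + (j - k * size sk) \notin work_regs by rewrite !inE; lia.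
  by rewrite m4X //; peel; rewrite fr3' ?hX //; rewrite /K; lia.
- by move=> j hj; have := V3 j hj; rewrite -/K /Vof fr5 ?fr4' //; rewrite ?/OB; lia.
- exact: eq_rows_ok okW3.
- case: hk3 => e1 e2 e3 e4; split=> //.
    by move=> phi /e2; apply: eq_annih.
  by rewrite (eq_potential (W' := Wof K M m3)) // => a ha; apply: WE.
Qed.

Definition sparsify_time k d q U (ts : seq (term k)) n l : nat :=
  let M := U * n.+1 ^ d in
  31 + d * (6 + n.+1 * 3) + M * 3 + l * (filter_time q n M ts).+1 + k * l * 5.

Lemma wp_sparsify k d q U (ts : seq (term k)) n (s : seq (constraint k n)) :
  let M := U * n.+1 ^ d in
  1 < q -> all (fun t : term k => [&& t.1.1 < U, t.1.2 < q & size t.2 == d]) ts ->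
  wp (sparsify d q U ts) (sparsify_time d q U ts n (size s))
    (fun y => exists sk, dout y = encode sk /\
       exists2 W, rows_ok q M W & kept_ok q M ts W s sk)
    (Data (fun=> 0) (encode s) [::]).
Proof.
move=> M q1 hts; set Q := fun y : data => _; set l := size s.
have htc (c : constraint k n) :
    all (fun t : term k => (term_index n.+1 (digit c) t < M) && (t.1.2 < q)) ts.
  apply: sub_all hts => t /and3P[hu -> /eqP ht]; rewrite andbT /M -ht.
  rewrite -(size_map (digit c)); apply: radix_lt => //.
  by rewrite all_map; apply/allP => -[x|] _ //=; rewrite ltnS ltnW.
apply: (@wp_time _ ((21 + d * (6 + n.+1 * 3) + M * 3) +
  ((3 + l * (filter_time q n M ts).+1) + (7 + k * l * 5)))); last first.
  by rewrite /sparsify_time -/M; lia.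
apply/wp_seq/wp_setup; rewrite -/M; first by lia.
move=> m hc m13 m12 m11 m0.
(* [s1] has been processed and [s2] is unread; the length of [s2] is both the loop bound and the
   content of register 13. *)
pose I c y := exists m' s1 s2 sk, [/\ y = Data m' (blocks s2) [::], s = s1 ++ s2,
  size s2 = c /\ m' 13 = c & loop_inv q M ts s1 sk m'].
apply/wp_seq/(@wp_while _ _ _ I).
- move=> c _ [m' [s1 [s2 [sk [-> sE [sz m'13] inv]]]]] /=; rewrite m'13 => lt0.
  case: s2 sz sE => [|c0 s2] /= sz sE; first by lia.
  exists (size s2) => //.
  apply: wp_weaken (wp_filter_one _ q1 (htc c0) inv) (leqnn _) _.
  move=> _ [m'' [sk' [-> m''13 inv'']]]; exists m'', (rcons s1 c0), s2, sk'; split=> //.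
    by rewrite cat_rcons.
  by rewrite m''13 m'13 -sz; lia.
- move=> c _ [m' [s1 [s2 [sk [-> sE [sz m'13] inv]]]]] /=; rewrite m'13 => c0.
  move: sE; rewrite (size0nil (etrans sz c0)) cats0 => sE.
  case: inv => i1 i2 i3 i4 i5 i6 i7.
  have le_sk : size sk <= l.
    by case: i7 => [/size_subseq le_sk _ _ _]; rewrite /l sE.
  apply: (@wp_time _ (7 + (k * size sk) * 5)).
    2: by rewrite leq_add2l leq_mul2r leq_mul2l le_sk orbT.
  apply: (@wp_print n q M (29+k) (k*size sk) m' _ _ Q i1 i3) => [|m'' i'']; first by lia.
  exists sk; split; last by exists (Wof (29 + k) M m') => //; rewrite sE.
  rewrite /= i2 /encode -/(blocks sk); congr [:: _, _ & _].
  apply: (@eq_from_nth _ 0); rewrite size_map size_iota ?size_blocks // => j hj.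
  by rewrite (nth_map 0) ?size_iota // nth_iota // add0n i4.
- rewrite /=; exists (upd m 0 1), [::], s, [::]; split=> //.
  apply: (@loop_inv_frame _ _ _ _ _ _ _ m).
  + by move=> a; rewrite !inE => ha; peel.
  + by move=> a ha; peel.
  (* Memory starts at zero, and a zero table has valid rows that every functional kills. *)
  have W0 a b : Wof (29 + k) M m a b = 0 by rewrite /Wof m0 //; lia.
  split=> //=.
  + by rewrite muln0 addn0.
  + by rewrite muln0.
  + by move=> j hj; rewrite /Vof m0 //; lia.
  + move=> a ha; split; first by rewrite W0; apply: ltn_trans q1.
      by move=> b _; rewrite W0.
    by move=> b _; left; rewrite W0.
  + by split=> // phi _ a ha; apply: dotv0.
Qed.

(** * Polynomial bounds on the running time *)

Lemma leq_expl m n e : m <= n -> m ^ e <= n ^ e.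
Proof. by case: e => // e; rewrite leq_exp2r. Qed.

(** Closure under sums, products, successors and fixed powers lets the bound be read off the syntax
    of [sparsify_time]. *)
Definition poly_bounded (f : nat -> nat -> nat) : Prop :=
  exists a b, forall n l, f n l <= a * (n + l).+1 ^ b.

Lemma poly_const c : poly_bounded (fun _ _ => c).
Proof. by exists c, 0 => n l; rewrite muln1. Qed.

Lemma poly_left : poly_bounded (fun n _ => n).
Proof. by exists 1, 1 => n l; lia. Qed.

Lemma poly_right : poly_bounded (fun _ l => l).
Proof. by exists 1, 1 => n l; lia. Qed.

Lemma poly_add f g : poly_bounded f -> poly_bounded g -> poly_bounded (fun n l => f n l + g n l).
Proof.
move=> [a [b h]] [a' [b' h']]; exists (a + a'), (b + b') => n l.
rewrite mulnDl; apply: leq_add; [apply: leq_trans (h n l) _ | apply: leq_trans (h' n l) _];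
  by rewrite leq_mul2l leq_pexp2l ?orbT // ?leq_addr ?leq_addl.
Qed.

Lemma poly_mul f g : poly_bounded f -> poly_bounded g -> poly_bounded (fun n l => f n l * g n l).
Proof.
move=> [a [b h]] [a' [b' h']]; exists (a * a'), (b + b') => n l.
by rewrite expnD mulnACA; apply: leq_mul.
Qed.

Lemma poly_succ f : poly_bounded f -> poly_bounded (fun n l => (f n l).+1).
Proof.
move=> [a [b h]]; exists a.+1, b => n l.
by rewrite mulSn -add1n leq_add ?expn_gt0.
Qed.

Lemma poly_exp f d : poly_bounded f -> poly_bounded (fun n l => f n l ^ d).
Proof.
move=> [a [b h]]; exists (a ^ d), (b * d) => n l.
by rewrite expnM -expnMn; apply: leq_expl.
Qed.

Lemma poly_terms_time k (ts : seq (term k)) : poly_bounded (fun n _ => terms_time n ts).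
Proof.
elim: ts => [|t ts [a [b h]]].
  by exists 0, 0 => n l; rewrite /terms_time big_nil.
have [a' [b' h']] : poly_bounded (fun n l =>
    (12 + size t.2 * (6 + n.+1 * 3)) + a * (n + l).+1 ^ b).
  repeat first [exact: poly_const | exact: poly_left | exact: poly_right | apply: poly_add
    | apply: poly_mul | apply: poly_succ | apply: poly_exp].
exists a', b' => n l; apply: leq_trans (h' n l).
by rewrite /terms_time big_cons leq_add2l h.
Qed.

Lemma poly_sparsify_time k d q U (ts : seq (term k)) : poly_bounded (sparsify_time d q U ts).
Proof.
rewrite /sparsify_time /filter_time.
repeat first [exact: poly_const | exact: poly_left | exact: poly_right
  | exact: poly_terms_time | apply: poly_add
  | apply: poly_mul | apply: poly_succ | apply: poly_exp].
Qed.

(** * Assignments as functionals *)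

Section Evaluation.
Context (k n : nat) (q : nat) (f : 'I_n -> bool).

(** The padding digit [n] is no variable index, so [insub] fails on it and it takes the value 1. *)
Definition digit_value (x : nat) : 'Z_q :=
  (if insub x is Some i then nat_of_bool (f i) else 1)%:R%R.

Lemma prod_digit_value (c : constraint k n) (w : seq (option 'I_k)) :
  (\prod_(x <- [seq digit c o | o <- w]) digit_value x = (monval (map_tuple f c) w)%:R :> 'Z_q)%R.
Proof.
rewrite big_map /monval natr_prod; apply: eq_bigr => -[i|] _ /=.
  by rewrite /digit_value valK tnth_map.
by rewrite /digit_value insubN // -leqNgt.
Qed.

End Evaluation.

(** Each tuple [u] owns a block of columns, numbered by its rank, so that a functional can single
    out the polynomial of one [u]. *)
Definition all_terms k (ts : k.-tuple bool -> seq (nat * seq (option 'I_k))) : seq (term k) :=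
  flatten [seq [seq (val (enum_rank u), t.1, t.2) | t <- ts u] | u <- enum {: k.-tuple bool}].

(** The leading part [enum_rank u] kills the blocks of all other tuples. On its own block, [decode]
    multiplies the values of [f] along each word, which evaluates the terms of [u] at the tuple that
    [f] gives to [c]. *)
Lemma functional_all_terms k n q d (ts : k.-tuple bool -> seq (nat * seq (option 'I_k)))
    (f : 'I_n -> bool) (u : k.-tuple bool) (c : constraint k n) :
  (forall u, all (fun t => size t.2 == d) (ts u)) ->
  (functional n.+1 (all_terms ts) (digit c)
     (decode n.+1 (@digit_value n q f) (enum_rank u) d) =
   (termval (map_tuple f c) (ts u))%:R :> 'Z_q)%R.
Proof.
move=> hd; rewrite /functional /all_terms big_flatten /= big_map big_enum /= (bigD1 u) //=.
have hterm v t : t \in ts v ->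
    decode n.+1 (@digit_value n q f) (enum_rank u) d
      (term_index n.+1 (digit c) (val (enum_rank v), t.1, t.2)) =
    ((v == u)%:R * (monval (map_tuple f c) t.2)%:R)%R.
  move=> ht; have /eqP <- := allP (hd v) t ht.
  rewrite /term_index -(size_map (digit c)) decode_radix.
    by rewrite prod_digit_value (inj_eq val_inj) (inj_eq enum_rank_inj).
  by rewrite all_map; apply/allP => -[x|] _ //=; rewrite ltnS ltnW.
rewrite [X in (_ + X)%R]big1 ?addr0 => [|v ne].
  rewrite big_map /termval natr_sum big_seq [RHS]big_seq; apply: eq_bigr => t ht.
  by rewrite hterm // eqxx mul1r natrM.
rewrite big_map big_seq big1 // => t ht.
by rewrite hterm // (negPf ne) mul0r mulr0.
Qed.

Theorem theorem3p3 (k d : nat) (R : {set k.-tuple bool})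
    (hR : forall u : k.-tuple bool, u \notin R -> capturable R d u) :
  exists (P : program) (a b c : nat),
    forall (n : nat) (C : {set constraint k n}) (s : seq (constraint k n)),
      lists s C ->
      exists (C' : {set constraint k n}) (s' : seq (constraint k n)),
        [/\ lists s' C',
            computes_within P (a * (n + #|C|).+1 ^ b) (encode s) (encode s'),
            C' \subset C,
            0 < n -> #|C'| <= c * n ^ d
          & forall f : 'I_n -> bool,
              satisfies_all R f C <-> satisfies_all R f C'].
Proof.
have [q [ts [q1 hts tsR tsu]]] := common_modulus hR.
pose U := #|{: k.-tuple bool}|; pose tt := all_terms ts.
have htt : all (fun t : term k => [&& t.1.1 < U, t.1.2 < q & size t.2 == d]) tt.
  apply/allP => _ /flattenP[_ /mapP[u _ ->] /mapP[t ht ->]] /=.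
  by have := allP (hts u) t ht; rewrite ltn_ord.
have hd u : all (fun t => size t.2 == d) (ts u).
  by apply: sub_all (hts u) => t /andP[].
have [a [b hab]] := poly_sparsify_time d q U tt.
(* The potential is at most [q * (U * n.+1 ^ d)], and [n.+1 <= 2 * n] for positive [n]; this is the
   constant. *)
exists (compile 0 (sparsify d q U tt)), a, b, (q * U * 2 ^ d) => n C s [us sC].
have szs : size s = #|C| by rewrite -(card_uniqP us); apply: eq_card.
have := wp_sparsify s q1 htt.
rewrite szs => /wp_time /(_ (hab n #|C|)) /wp_computes.
move=> [y [sk [-> [W okW [ksub _ kpot kskip]]]] run].
have usk : uniq sk := subseq_uniq ksub us.
exists [set c in sk], sk; split=> //.
- by split=> // c; rewrite inE.
- by apply/subsetP => c; rewrite inE -sC; apply: mem_subseq.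
- move=> n0; rewrite cardsE (card_uniqP usk); apply: leq_trans kpot _.
  apply: leq_trans (potential_le okW) _; rewrite -!mulnA -expnMn !leq_mul2l leq_expl ?orbT //; lia.
move=> f; split=> hf c hc.
  by apply: hf; move: hc; rewrite inE -sC; apply: mem_subseq.
(* Were [c] violated, its tuple [u] under [f] would lie outside [R]. The functional of [f] and [u]
   vanishes on the kept constraints, whose tuples lie in [R], hence on [c]; but there it evaluates
   the terms of [u] at [u] itself, which is nonzero modulo [q]. *)
apply: contraT => /tsu; rewrite -(Zq_natr_eq0 _ q1) -(functional_all_terms _ _ _ _ hd).
rewrite kskip ?eqxx ?sC // => c' hc'; rewrite (functional_all_terms _ _ _ _ hd).
apply/eqP; rewrite Zq_natr_eq0 //; apply/tsR/hf; by rewrite inE.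
Qed.
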